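(* Let $\kappa : [0,1]^2 \to (0,1)$ be a kernel (a symmetric measurable function) that is continuous and attains its maximum value at the point $(c,c)$ for some $c \in [0,1]$, and let $p_{\max} := \kappa(c,c)$. Let $\gamma$ satisfy $p_{\max} < \gamma \le 1$, and for each $n \in \mathbb{N}$ define $$\omega^{(\gamma)}_n := \frac{2\log(n)}{D(\gamma, p_{\max})},$$ where $D(\gamma,p)$ is the Kullback-Leibler divergence between the Bernoulli distributions $\mathrm{Bern}(\gamma)$ and $\mathrm{Bern}(p)$, given by $$D(\gamma,p) := \begin{cases} \gamma \log\left(\frac{\gamma}{p}\right) + (1-\gamma)\log\left(\frac{1-\gamma}{1-p}\right) & \text{if } \gamma < 1,\\ \log\left(\frac{1}{p}\right) & \text{if } \gamma = 1.\end{cases}$$ For each $n$, let $G = G_n$ be a random graph distributed according to the inhomogeneous random graph model $\mathbb{G}(n,\kappa)$, and let $\omega^{(\gamma)}(G)$ denote its $\gamma$-quasi-clique number. Then, for every $\epsilon > 0$, $$\mathbb{P}\Bigl(\omega^{(\gamma)}(G) \in \bigl[(1-\epsilon)\,\omega^{(\gamma)}_n,\ (1+\epsilon)\,\omega^{(\gamma)}_n\bigr]\Bigr) \to 1 \qquad \text{as } n \to \infty.$$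
   Context: Graphs are simple. For a graph $G=(V,E)$ and $S \subseteq V$, $G[S]$ denotes the subgraph induced by $S$, i.e. the graph with vertex set $S$ whose edges are the edges of $G$ with both endpoints in $S$. Quasi-clique number: for $\gamma \in [0,1]$, the $\gamma$-quasi-clique number $\omega^{(\gamma)}(G)$ is the size of the largest subset of vertices $S \subseteq V$ such that $G[S]$ contains at least $\gamma\binom{|S|}{2}$ edges. (For $\gamma=1$ this is the clique number.) Random graph model $\mathbb{G}(n,\kappa)$: a kernel is a symmetric measurable function $\kappa:[0,1]^2\to(0,1)$. An element of $\mathbb{G}(n,\kappa)$ is a simple random graph $G=(V,E)$ with vertex set $V=[n]:=\{1,\dots,n\}$ and random edge set $E$, generated as follows. Each vertex $i\in V$ is assigned a weight $W_i \sim \mathrm{Unif}(0,1)$, the weights being independent. Conditionally on the weights $(W_k)_{k\in V}$, the presences of edges between distinct pairs of vertices $i \ne j$ are independent Bernoulli random variables with success probability $$p_{ij} := \mathbb{P}\bigl((i,j)\in E \mid (W_k)_{k\in V}\bigr) = \kappa(W_i,W_j).$$ The kernel $\kappa$ and the distribution of the vertex weights do not depend on $n$; the parameter $\gamma$ is a constant not depending on $n$. $\log$ is the natural logarithm. *)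

(* Defs.v *)
From mathcomp Require Import all_boot all_order all_algebra.
From mathcomp Require Import all_classical all_reals all_analysis.

Set Implicit Arguments.
Unset Strict Implicit.
Unset Printing Implicit Defensive.

Import Order.TTheory GRing.Theory Num.Theory.
Import numFieldNormedType.Exports.

Local Open Scope classical_set_scope.
Local Open Scope ring_scope.

(* A simple graph on the vertex set 'I_n is a symmetric irreflexive relation;
   an unordered pair of distinct vertices is encoded as (i, j) with i < j. *)
Definition vertex_pairs (n : nat) : {set 'I_n * 'I_n} :=
  [set ij : 'I_n * 'I_n | (ij.1 < ij.2)%N]%SET.

Definition induced_edges (n : nat) (e : rel 'I_n) (S : {set 'I_n}) :
    {set 'I_n * 'I_n} :=
  [set ij in vertex_pairs n | [&& ij.1 \in S, ij.2 \in S & e ij.1 ij.2]]%SET.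

Definition quasi_clique (R : realType) (gamma : R) (n : nat) (e : rel 'I_n)
    (S : {set 'I_n}) : bool :=
  gamma * 'C(#|S|, 2)%:R <= #|induced_edges e S|%:R.

Definition quasi_clique_number (R : realType) (gamma : R) (n : nat)
    (e : rel 'I_n) : nat :=
  \max_(S : {set 'I_n} | quasi_clique gamma e S) #|S|.

Definition unit_square (R : realType) : set (R * R) :=
  `[0, 1]%classic `*` `[0, 1]%classic.
Arguments unit_square : clear implicits.

(* Only the values of kappa on [0, 1]^2 are meaningful. *)
Definition graph_kernel (R : realType) (kappa : R * R -> R) : Prop :=
  [/\ measurable_fun (unit_square R) kappa,
      forall x y, unit_square R (x, y) -> kappa (x, y) = kappa (y, x)
    & forall z, unit_square R z -> 0 < kappa z < 1].

(* Mutual independence of a finite family of real random variables. *)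
Definition mutually_independent (R : realType) (d : measure_display)
    (T : measurableType d) (P : probability T R) (n : nat)
    (W : 'I_n -> {RV P >-> R}) : Prop :=
  forall (S : {set 'I_n}) (B : 'I_n -> set R),
    (forall i, i \in S -> measurable (B i)) ->
    P [set t | forall i, i \in S -> B i (W i t)] =
    (\prod_(i in S) P (W i @^-1` B i))%E.

(* Y is a version of the conditional probability P(A | F), where F is a
   sub-sigma-algebra of the measurable sets. *)
Definition cond_prob_version (R : realType) (d : measure_display)
    (T : measurableType d) (P : probability T R) (F : set (set T))
    (A : set T) (Y : T -> R) : Prop :=
  [/\ forall U, measurable U -> F (Y @^-1` U),
      P.-integrable setT (EFin \o Y)
    & forall B, F B -> P (A `&` B) = (\int[P]_(t in B) (Y t)%:E)%E].

(* The last field says that, conditionally on sigma(W_1, ..., W_n), the edge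
   indicators are independent and that of {i, j} is Bern(kappa(W_i, W_j)):
   every finite-dimensional conditional probability is the product of the
   corresponding Bernoulli masses.  The weights take values in [0, 1], the
   domain of kappa, everywhere and not just almost surely. *)
Record inhomogeneous_random_graph (R : realType) (kappa : R * R -> R)
    (n : nat) (d : measure_display) (T : measurableType d)
    (P : probability T R) (W : 'I_n -> {RV P >-> R}) (G : T -> rel 'I_n) :
    Prop := {
  irg_weight_range : forall i t, W i t \in `[0, 1];
  irg_weight_uniform : forall i (B : set R), measurable B ->
    distribution P (W i) B = uniform_prob (@ltr01 R) B;
  irg_weight_indep : mutually_independent W;
  irg_simple : forall t, symmetric (G t) /\ irreflexive (G t);
  irg_measurable : forall i j, measurable [set t | G t i j];
  irg_edges : forall (F : {set 'I_n * 'I_n}) (b : 'I_n * 'I_n -> bool),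
    F \subset vertex_pairs n ->
    cond_prob_version P (g_sigma_preimage (fun i => W i : T -> R))
      [set t | forall ij, ij \in F -> G t ij.1 ij.2 = b ij]
      (fun t => \prod_(ij in F)
        bernoulli_pmf (kappa (W ij.1 t, W ij.2 t)) (b ij)) }.

(* Kullback-Leibler divergence between Bern(gamma) and Bern(p). *)
Definition bernoulli_kl (R : realType) (gamma p : R) : R :=
  if gamma < 1 then
    gamma * ln (gamma / p) + (1 - gamma) * ln ((1 - gamma) / (1 - p))
  else ln (1 / p).

Definition typical_size (R : realType) (gamma p : R) (n : nat) : R :=
  2 * ln n%:R / bernoulli_kl gamma p.

(* Main.v *)
Require Import Defs.
From mathcomp Require Import all_boot all_order all_algebra.
From mathcomp Require Import all_classical all_reals all_analysis.
From mathcomp Require Import ring lra.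

Set Implicit Arguments.
Unset Strict Implicit.
Unset Printing Implicit Defensive.

Import Order.TTheory GRing.Theory Num.Theory.
Import numFieldNormedType.Exports.

Local Open Scope classical_set_scope.
Local Open Scope ring_scope.

(** Let D be the divergence between Bern(gamma) and Bern(pmax).  Conditionally on
    the weights the edges are independent, so the probability of an event about
    the graph is the average over the weights of its probability under a finite
    product of Bernoulli measures on sets of vertex pairs ([edge_set_prob]).  Both
    halves of the theorem are proved for such products, uniformly in the edge
    probabilities.

    Upper bound.  All edge probabilities are at most pmax, so the Chernoff bound
    [upper_tail] makes a given set of s vertices dense with probability at most
    exp (- D s (s - 1) / 2).  For s above (1 + eps) 2 ln n / D this is at most
    rho ^+ s for some rho with n rho -> 0, and the sum of rho ^+ #|S| over the
    nonempty sets S of vertices is at most exp (n rho) - 1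
    ([prob_large_dense_small]).

    Lower bound.  By continuity kappa is at least p0, slightly below pmax, on a
    window of length r around c, and with high probability at least r n / 2
    vertices have their weight in the window.  Among these, a dense set of k
    vertices is found by the second moment method.  For gamma < 1 the number of
    dense sets itself can have too large a variance: sets with an exceptionally
    dense core contribute too much to it.  Instead, each set S is weighted by the
    likelihood ratio between the law in which the pairs inside S are edges with
    probability q, slightly above gamma (or q = 1 when gamma = 1), and the actual
    law; and only good sets are counted, those that are dense and whose subsets B
    all have likelihood ratio at most exp (sigma #|B|).  The weight of S has mean
    the probability of being good under the tilted law, which tends to 1.  The
    product of the weights of S and S' has mean at most exp (sigma #|S :&: S'|),
    because it is the likelihood ratio of the union times that of the
    intersection.  Summing over overlaps, the second moment exceeds the square of
    the number of sets by a factor at most exp (exp sigma * k ^+ 2 / m), where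
    m >= r n / 2 is the number of vertices available ([prob_no_good_set]).  With
    k <= (1 - eps) 2 ln n / D + 1 one can take sigma = (1 - eps / 2) ln n, and the
    factor tends to 1 ([prob_no_dense_small]). *)

(** * Finite products of Bernoulli measures *)

Section BernoulliProduct.
Variables (R : realType) (I : finType).
Implicit Types (p : I -> R) (x J : {set I}) (f : {set I} -> R) (E F G : pred {set I}).

Definition config_mass p x : R := \prod_i (if i \in x then p i else 1 - p i).

Definition expect p f : R := \sum_x config_mass p x * f x.

Definition prob p (E : pred {set I}) : R := expect p (fun x => (E x)%:R).

Lemma config_mass_ge0 p x : (forall i, 0 <= p i <= 1) -> 0 <= config_mass p x.
Proof.
move=> p01; apply: prodr_ge0 => i _; have /andP[p0 p1] := p01 i.
by case: ifP => // _; rewrite subr_ge0.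
Qed.

(** Independence of the coordinates: every exponential moment computed below
    is the expectation of such a product. *)
Lemma expect_prod p J (g h : I -> R) :
  expect p (fun x => \prod_(i in J) (if i \in x then g i else h i)) =
  \prod_(i in J) (p i * g i + (1 - p i) * h i).
Proof.
pose g' i := if i \in J then g i else 1; pose h' i := if i \in J then h i else 1.
transitivity (\prod_i (p i * g' i + (1 - p i) * h' i)).
  rewrite bigA_distr; apply: eq_bigr => x _.
  rewrite /config_mass [X in _ * X]big_mkcond -big_split; apply: eq_bigr => i _.
  by rewrite /g' /h'; case: (i \in x); case: (i \in J).
rewrite [RHS]big_mkcond; apply: eq_bigr => i _ /=.
by rewrite /g' /h'; case: ifP => // _; rewrite !mulr1 addrC subrK.
Qed.

Lemma sum_config_mass p : \sum_x config_mass p x = 1.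
Proof.
have := expect_prod p finset.set0 (fun=> 0) (fun=> 0).
by rewrite finset.big_set0 => <-; apply: eq_bigr => x _; rewrite finset.big_set0 mulr1.
Qed.

Lemma expect_sum p (K : Type) (s : seq K) (P : pred K) (f : K -> {set I} -> R) :
  expect p (fun x => \sum_(k <- s | P k) f k x) =
  \sum_(k <- s | P k) expect p (f k).
Proof.
rewrite /expect exchange_big /=; apply: eq_bigr => x _.
by rewrite mulr_sumr.
Qed.

Lemma expectZ p (a : R) f : expect p (fun x => a * f x) = a * expect p f.
Proof. by rewrite mulr_sumr; apply: eq_bigr => x _; rewrite mulrCA. Qed.

Lemma le_expect p f g : (forall i, 0 <= p i <= 1) ->
  (forall x, f x <= g x) -> expect p f <= expect p g.
Proof.
by move=> p01 fg; apply: ler_sum => x _; rewrite ler_wpM2l ?config_mass_ge0.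
Qed.

Lemma prob_le1 p E : (forall i, 0 <= p i <= 1) -> prob p E <= 1.
Proof.
move=> p01; rewrite -(sum_config_mass p); apply: ler_sum => x _.
by rewrite ler_piMr ?config_mass_ge0 //; case: (E x).
Qed.

Lemma probC p E : prob p E = 1 - prob p (predC E).
Proof.
rewrite -(sum_config_mass p) -sumrB; apply: eq_bigr => x _ /=.
by case: (E x); rewrite ?mulr1 ?mulr0 ?subr0 ?subrr.
Qed.

Lemma prob_markov p E f : (forall i, 0 <= p i <= 1) ->
  (forall x, 0 <= f x) -> (forall x, E x -> 1 <= f x) ->
  prob p E <= expect p f.
Proof.
move=> p01 f0 Ef; apply: le_expect => // x.
by case: (boolP (E x)) => [/Ef|].
Qed.

Lemma prob_union p (K : finType) (P : pred K) (E : pred {set I})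
    (F : K -> pred {set I}) : (forall i, 0 <= p i <= 1) ->
  (forall x, E x -> exists2 k, P k & F k x) ->
  prob p E <= \sum_(k | P k) prob p (F k).
Proof.
move=> p01 EF; rewrite /prob -expect_sum; apply: prob_markov => // x.
  by apply: sumr_ge0.
move=> /EF[k Pk Fkx]; rewrite (bigD1 k) //= Fkx lerDl.
exact: sumr_ge0.
Qed.

Lemma prob_le p E F : (forall i, 0 <= p i <= 1) ->
  (forall x, E x -> F x) -> prob p E <= prob p F.
Proof.
move=> p01 EF; apply: prob_markov => // x /EF ->.
by rewrite lexx.
Qed.

Lemma prob_le_add p E F G : (forall i, 0 <= p i <= 1) ->
  (forall x, E x -> F x || G x) -> prob p E <= prob p F + prob p G.
Proof.
move=> p01 EFG; rewrite /prob /expect -big_split /=; apply: ler_sum => x _.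
rewrite -mulrDr ler_wpM2l ?config_mass_ge0 //.
case: (boolP (E x)) => [/EFG/orP[]->|_]; by rewrite ?addr_ge0 ?lerDl ?lerDr.
Qed.

(** Chebyshev: where f vanishes it is away from its mean by the mean itself. *)
Lemma prob_second_moment p f : (forall i, 0 <= p i <= 1) ->
  prob p (fun x => f x == 0) * expect p f ^+ 2 <=
  expect p (fun x => f x ^+ 2) - expect p f ^+ 2.
Proof.
move=> p01; move mE : (expect p f) => m.
have -> : expect p (fun x => f x ^+ 2) - m ^+ 2 =
          expect p (fun x => (f x - m) ^+ 2).
  rewrite /expect [RHS](eq_bigr (fun x => config_mass p x * f x ^+ 2 +
    (- (2 * m) * (config_mass p x * f x) + m ^+ 2 * config_mass p x))); last first.
    by move=> x _ /=; ring.
  by rewrite !big_split -!mulr_sumr sum_config_mass [\sum_i _ * f i]mE /=; ring.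
rewrite /prob mulrC -expectZ; apply: le_expect => // x.
case: eqP => [->|_]; last by rewrite mulr0 sqr_ge0.
by rewrite mulr1 sub0r sqrrN.
Qed.


Definition tilt p (q : R) J : I -> R := fun i => if i \in J then q else p i.

(** The density of the product with parameters [tilt p q J] with respect to
    the one with parameters p. *)
Definition likelihood p (q : R) J x : R :=
  \prod_(i in J) (if i \in x then q / p i else (1 - q) / (1 - p i)).

Lemma tilt01 p q J : (forall i, 0 <= p i <= 1) -> 0 <= q <= 1 ->
  forall i, 0 <= tilt p q J i <= 1.
Proof. by move=> p01 q01 i; rewrite /tilt; case: ifP. Qed.

Lemma expect_likelihood p q J f : (forall i, i \in J -> 0 < p i < 1) ->
  expect p (fun x => likelihood p q J x * f x) = expect (tilt p q J) f.
Proof.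
move=> p01; apply: eq_bigr => x _; rewrite mulrA; congr (_ * _).
rewrite /likelihood /config_mass [X in _ * X]big_mkcond -big_split.
apply: eq_bigr => i _ /=; rewrite /tilt; case: (boolP (i \in J)) => [iJ|_]; last first.
  by case: ifP => _; rewrite mulr1.
have /andP[p0 p1] := p01 i iJ.
by case: ifP => _; rewrite mulrC divfK // gt_eqF // subr_gt0.
Qed.

Lemma likelihood_ge0 p q J x : 0 <= q <= 1 ->
  (forall i, i \in J -> 0 < p i < 1) -> 0 <= likelihood p q J x.
Proof.
move=> /andP[q0 q1] p01; apply: prodr_ge0 => i /p01 /andP[p0 p1].
by case: ifP => _; rewrite divr_ge0 // ?subr_ge0 // ltW.
Qed.

(** The likelihood ratios of J and K count the coordinates in the intersection
    twice.  In the second moment this isolates the effect of an overlap. *)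
Lemma likelihoodU p q J K x :
  likelihood p q J x * likelihood p q K x =
  likelihood p q (J :|: K)%SET x * likelihood p q (J :&: K)%SET x.
Proof.
rewrite /likelihood (finset.big_setID K) [X in _ = X * _](finset.big_setID K) /=.
rewrite [((J :|: K) :&: K)%SET]finset.setIC finset.setIUr finset.setIid.
rewrite (finset.setUidPr (finset.subsetIl K J)) finset.setDUl finset.setDv finset.setU0.
by rewrite -mulrA mulrC [X in X * _ = _]mulrC.
Qed.

End BernoulliProduct.
(** * Exponential tail bounds *)

Section ExponentialTails.
Variable R : realType.

(** From exp (- y) >= 1 - y one gets exp y <= 1 / (1 - y), which is within the
    quadratic bound because y ^+ 2 * (1 - 2 * y) >= 0. *)
Lemma expR_le_quadratic (y : R) : `|y| <= 1 / 2 -> expR y <= 1 + y + 2 * y ^+ 2.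
Proof.
rewrite ler_norml => /andP[y_ge y_le].
have y1 : 0 < 1 - y by lra.
have e1 : 1 - y <= expR (- y) by exact: expR_ge1Dx.
have : expR y <= (1 - y)^-1.
  by rewrite -[expR y]invrK -expRN lef_pV2 // posrE ?expR_gt0.
move/le_trans; apply.
rewrite -[leLHS]mul1r ler_pdivrMr //.
have -> : (1 + y + 2 * y ^+ 2) * (1 - y) = 1 + y ^+ 2 * (1 - 2 * y) by ring.
by rewrite lerDl mulr_ge0 ?sqr_ge0 //; lra.
Qed.

(** To first order in s the exponential moment is 1 plus s times the mean, so
    a negative mean brings it below 1.  This gives the exponential decay in
    both tail bounds that follow; their rates need not be optimal. *)
Lemma exp_moment_lt1 (q u v : R) : 0 <= q <= 1 -> q * u + (1 - q) * v < 0 ->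
  exists s r : R, [/\ 0 < s, 0 < r < 1 &
    q * expR (s * u) + (1 - q) * expR (s * v) <= r].
Proof.
move=> /andP[q0 q1] mean_lt0.
pose M : R := `|u| + `|v| + 1; pose m := - (q * u + (1 - q) * v).
have m0 : 0 < m by rewrite /m; lra.
have uM : `|u| <= M by rewrite /M; have := normr_ge0 v; lra.
have vM : `|v| <= M by rewrite /M; have := normr_ge0 u; lra.
have M0 : 0 < M by rewrite /M; have := normr_ge0 u; have := normr_ge0 v; lra.
pose s := Num.min (1 / 2 / M) (m / (4 * M ^+ 2)).
have M2 : 0 < 4 * M ^+ 2 by rewrite mulr_gt0 // exprn_gt0.
have s0 : 0 < s by rewrite lt_min !divr_gt0.
have sM : s * M <= 1 / 2 by rewrite -ler_pdivlMr // ge_min lexx.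
have sm : s * (4 * M ^+ 2) <= m by rewrite -ler_pdivlMr // ge_min lexx orbT.
have term w : `|w| <= M -> expR (s * w) <= 1 + s * w + 2 * (s ^+ 2 * M ^+ 2).
  move=> wM; have sw : `|s * w| <= s * M by rewrite normrM gtr0_norm // ler_pM2l.
  apply: (le_trans (expR_le_quadratic (le_trans sw sM))).
  rewrite lerD2l ler_pM2l // -real_normK ?num_real // -exprMn.
  by rewrite lerXn2r ?nnegrE // mulr_ge0 // ltW.
have le_r : q * expR (s * u) + (1 - q) * expR (s * v) <= 1 - s * m / 2.
  have eu := ler_wpM2l q0 (term _ uM).
  have q1' : 0 <= 1 - q by lra.
  have ev := ler_wpM2l q1' (term _ vM).
  apply: (le_trans (lerD eu ev)).
  have -> : q * (1 + s * u + 2 * (s ^+ 2 * M ^+ 2)) +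
      (1 - q) * (1 + s * v + 2 * (s ^+ 2 * M ^+ 2)) =
      1 - s * m + s * (s * (4 * M ^+ 2)) / 2 by rewrite /m; field.
  have := ler_wpM2l (ltW s0) sm; lra.
exists s, (1 - s * m / 2); split=> //.
have sm0 : 0 < s * m by rewrite mulr_gt0.
apply/andP; split; last by lra.
apply: lt_le_trans le_r; have := expR_gt0 (s * u); have := expR_gt0 (s * v).
move=> ev eu; case: (ltP 0 q) => [qp|q_le].
  apply: ltr_wpDr; last exact: mulr_gt0.
  by rewrite mulr_ge0 ?subr_ge0 // ltW.
have -> : q = 0 by lra.
by rewrite mul0r add0r subr0 mul1r.
Qed.

(** The rate depends on q and gamma only, uniformly in J.  When q = 1 there is
    no randomness in J and the event has probability 0. *)
Lemma lower_tail (q gamma : R) : 0 <= q <= 1 ->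
  gamma < q \/ (q = 1 /\ gamma <= 1) ->
  exists2 r : R, 0 < r < 1 &
  forall (I : finType) (p : I -> R) (J : {set I}),
    (forall i, 0 <= p i <= 1) -> (forall i, i \in J -> p i = q) ->
    prob p (fun x => #|x :&: J|%:R < gamma * #|J|%:R) <= r ^+ #|J|.
Proof.
move=> q01 [gamma_lt|[q1 gamma_le1]]; last first.
  exists (1 / 2); first lra.
  move=> I p J p01 pJ; apply: (@le_trans _ _ 0); last by rewrite exprn_ge0.
  rewrite /prob /expect big1 // => x _.
  case: (boolP (J \subset x)) => [Jx|/fintype.subsetPn[i iJ ix]].
    rewrite (finset.setIidPr Jx) ltNge ler_piMl //= mulr0 //.
  by rewrite /config_mass (bigD1 i) //= (negPf ix) pJ // q1 subrr !mul0r.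
have [|s [r [s0 r01 le_r]]] := @exp_moment_lt1 q (gamma - 1) gamma q01.
  by lra.
exists r => // I p J p01 pJ.
pose g (x : {set I}) := \prod_(i in J)
  (if i \in x then expR (s * (gamma - 1)) else expR (s * gamma)).
apply: (@le_trans _ _ (expect p g)).
  apply: prob_markov => // [x|x lt_x].
    by apply: prodr_ge0 => i _; case: ifP => _; exact: expR_ge0.
  have -> : g x = expR (\sum_(i in J) s * (gamma - (i \in x)%:R)).
    rewrite expR_sum; apply: eq_bigr => i _.
    by case: (i \in x); rewrite ?subr0.
  rewrite -[leLHS]expR0 ler_expR -mulr_sumr sumrB.
  rewrite mulr_ge0 ?(ltW s0) // subr_ge0 sumr_const -mulr_natr -natr_sum.
  rewrite -big_mkcondr sum1_card; apply: ltW.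
  apply: le_lt_trans lt_x; rewrite ler_nat subset_leq_card //.
  by apply/fintype.subsetP => i; rewrite !inE andbC.
rewrite expect_prod.
have -> : \prod_(i in J) (p i * expR (s * (gamma - 1)) +
    (1 - p i) * expR (s * gamma)) =
    (q * expR (s * (gamma - 1)) + (1 - q) * expR (s * gamma)) ^+ #|J|.
  by rewrite -prodr_const; apply: eq_bigr => i iJ; rewrite pJ.
have /andP[q0 q1] := q01; have /andP[r0 _] := r01.
rewrite lerXn2r // ?nnegrE ?(ltW r0) //.
by rewrite addr_ge0 // mulr_ge0 ?expR_ge0 ?subr_ge0.
Qed.

(** Under the tilted law the logarithm of the likelihood ratio of one
    coordinate has mean the divergence of Bern(p i) from Bern(q), which is at
    most the bound assumed to be less than kl when p i lies between p0 and p1.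
    Since ln 0 = 0, the case q = 1 is covered: there the coordinates of T
    outside x have likelihood ratio 0, so the event forces T to lie in x. *)
Lemma likelihood_tail (q p0 p1 kl : R) : 0 < q <= 1 -> 0 < p0 -> p1 < 1 ->
  q * ln (q / p0) + (1 - q) * ln ((1 - q) / (1 - p1)) < kl ->
  exists2 r : R, 0 < r < 1 &
  forall (I : finType) (p : I -> R) (J T : {set I}),
    (forall i, 0 <= p i <= 1) -> (forall i, i \in J -> p0 <= p i <= p1) ->
    T \subset J ->
    prob (tilt p q J) (fun x => expR (kl * #|T|%:R) < likelihood p q T x)
      <= r ^+ #|T|.
Proof.
move=> /andP[q0 q1] p0_gt0 p1_lt1 kl_gt.
have q01 : 0 <= q <= 1 by rewrite ltW.
pose u := ln (q / p0) - kl; pose v := ln ((1 - q) / (1 - p1)) - kl.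
have [|s [r [s0 r01 le_r]]] := @exp_moment_lt1 q u v q01.
  by rewrite /u /v; lra.
exists r => // I p J T p01 pJ TJ.
have pT i : i \in T -> p0 <= p i <= p1 by move=> /(fintype.subsetP TJ) /pJ.
have tilt_01 := tilt01 J p01 q01.
pose g (x : {set I}) := \prod_(i in T) (if i \in x then expR (s * u) else expR (s * v)).
apply: (@le_trans _ _ (expect (tilt p q J) g)).
  apply: prob_markov => // [x|x lt_x].
    by apply: prodr_ge0 => i _; case: ifP => _; exact: expR_ge0.
  have lik_gt0 : 0 < likelihood p q T x by apply: le_lt_trans lt_x; exact: expR_ge0.
  (* On the event no factor vanishes, so logarithms of all factors exist. *)
  have q_lt1 i : i \in T -> i \notin x -> q < 1.
    move=> iT ix; rewrite lt_neqAle q1 andbT; apply: contraTN lik_gt0 => /eqP q_eq1.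
    by rewrite /likelihood (bigD1 i) //= (negPf ix) q_eq1 subrr !mul0r ltxx.
  pose c i := if i \in x then ln (q / p0) else ln ((1 - q) / (1 - p1)).
  have lik_le : likelihood p q T x <= expR (\sum_(i in T) c i).
    rewrite expR_sum; apply: ler_prod => i iT; have /andP[pi0 pi1] := pT i iT.
    have pi_gt0 : 0 < p i by exact: lt_le_trans pi0.
    have pi_lt1 : p i < 1 by exact: le_lt_trans p1_lt1.
    rewrite /c; case: (boolP (i \in x)) => [_|ix] /=.
      rewrite lnK ?posrE ?divr_gt0 //.
      apply/andP; split; first by rewrite ltW ?divr_gt0.
      by rewrite ler_pM2l // lef_pV2.
    have q'0 : 0 < 1 - q by rewrite subr_gt0 (q_lt1 i).
    have p'0 : 0 < 1 - p i by rewrite subr_gt0.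
    have p1'0 : 0 < 1 - p1 by rewrite subr_gt0.
    rewrite lnK ?posrE ?divr_gt0 //.
    apply/andP; split; first by rewrite ltW ?divr_gt0.
    by rewrite ler_pM2l // lef_pV2 ?posrE // lerD2l lerN2.
  have := lt_le_trans lt_x lik_le; rewrite ltr_expR => sum_gt.
  have -> : g x = expR (\sum_(i in T) s * (c i - kl)).
    rewrite expR_sum; apply: eq_bigr => i _.
    by rewrite /c; case: (i \in x).
  rewrite -[leLHS]expR0 ler_expR -mulr_sumr sumrB.
  rewrite mulr_ge0 ?(ltW s0) // subr_ge0 sumr_const -mulr_natr.
  exact: ltW.
rewrite expect_prod.
have -> : \prod_(i in T) (tilt p q J i * expR (s * u) +
    (1 - tilt p q J i) * expR (s * v)) =
    (q * expR (s * u) + (1 - q) * expR (s * v)) ^+ #|T|.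
  rewrite -prodr_const; apply: eq_bigr => i /(fintype.subsetP TJ) iJ.
  by rewrite /tilt iJ.
have /andP[r0 _] := r01.
rewrite lerXn2r // ?nnegrE ?(ltW r0) //.
by rewrite addr_ge0 // mulr_ge0 ?expR_ge0 ?subr_ge0 // ltW.
Qed.

End ExponentialTails.
(** * Large deviations above the mean *)

Section UpperTail.
Variable R : realType.

(** The convention ln 0 = 0 absorbs the case distinction at gamma = 1. *)
Lemma bernoulli_klE (gamma p : R) : gamma <= 1 ->
  bernoulli_kl gamma p =
  gamma * ln (gamma / p) + (1 - gamma) * ln ((1 - gamma) / (1 - p)).
Proof.
rewrite /bernoulli_kl le_eqVlt => /orP[/eqP->|->//].
by rewrite ltxx subrr mul0r addr0 [RHS]mul1r.
Qed.

(** Gibbs' inequality: ln x <= x - 1 for both logarithms, strictly for the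
    first one because p <> gamma. *)
Lemma bernoulli_kl_gt0 (gamma p : R) : 0 < p -> p < gamma -> gamma <= 1 ->
  0 < bernoulli_kl gamma p.
Proof.
move=> p0 pg g1; have g0 : 0 < gamma by exact: lt_trans pg.
have p1 : p < 1 by exact: lt_le_trans g1.
rewrite bernoulli_klE //.
have gt1 : gamma - p < gamma * ln (gamma / p).
  have : ln (p / gamma) < p / gamma - 1.
    rewrite -ltr_expR lnK ?posrE ?divr_gt0 //.
    have := @expR_gt1Dx R (p / gamma - 1).
    rewrite [1 + _]addrC subrK; apply; rewrite subr_eq0 lt_eqF //.
    by rewrite ltr_pdivrMr // mul1r.
  rewrite -(ltr_pM2l g0) mulrBr mulr1 [gamma * (p / _)]mulrC divfK ?gt_eqF //.
  rewrite -[gamma / p]invf_div lnV ?posrE ?divr_gt0 //; lra.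
have [g_lt1|] := ltP gamma 1; last first.
  move=> g_ge1; have -> : gamma = 1 by lra.
  rewrite subrr mul0r addr0; move: gt1; have -> : gamma = 1 by lra.
  by apply: lt_trans; rewrite subr_gt0.
have g'0 : 0 < 1 - gamma by rewrite subr_gt0.
have p'0 : 0 < 1 - p by rewrite subr_gt0.
have : p - gamma <= (1 - gamma) * ln ((1 - gamma) / (1 - p)).
  have : ln ((1 - p) / (1 - gamma)) <= (1 - p) / (1 - gamma) - 1.
    by rewrite -ler_expR lnK ?posrE ?divr_gt0 // (le_trans _ (expR_ge1Dx _)) // [leRHS]addrC subrK.
  rewrite -(ler_pM2l g'0) mulrBr mulr1.
  rewrite [X in _ <= X - _]mulrC divfK ?gt_eqF //.
  rewrite -[(1 - gamma) / _]invf_div lnV ?posrE ?divr_gt0 //; lra.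
lra.
Qed.

(** The Chernoff bound with its optimal rate.  The test function is the
    likelihood ratio of Bern(gamma) with respect to Bern(p1): it weights the
    elements of x more than the others, so its mean is at most 1 when the
    parameters are at most p1, and it is at least exp (D #|J|) on the event
    (below, each of its factors is multiplied by exp (- D)). *)
Lemma upper_tail (gamma p1 : R) (I : finType) (p : I -> R) (J : {set I}) :
  0 < p1 -> p1 < gamma -> gamma <= 1 ->
  (forall i, 0 <= p i <= 1) -> (forall i, i \in J -> p i <= p1) ->
  prob p (fun x => gamma * #|J|%:R <= #|x :&: J|%:R)
    <= expR (- (bernoulli_kl gamma p1 * #|J|%:R)).
Proof.
move=> p1_gt0 p1_lt gamma_le1 p01 pJ.
have gamma_gt0 : 0 < gamma by exact: lt_trans p1_lt.
have p1_lt1 : p1 < 1 by exact: lt_le_trans gamma_le1.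
have p1'0 : 0 < 1 - p1 by rewrite subr_gt0.
set D := bernoulli_kl gamma p1.
pose a : R := gamma / p1; pose b : R := (1 - gamma) / (1 - p1).
have a_gt0 : 0 < a by rewrite divr_gt0.
have b_ge0 : 0 <= b by rewrite divr_ge0 ?subr_ge0 // ltW.
have ab : b <= a.
  apply: (@le_trans _ _ 1); first by rewrite ler_pdivrMr // mul1r; lra.
  by rewrite ler_pdivlMr // mul1r ltW.
pose g (x : {set I}) :=
  \prod_(i in J) (if i \in x then a * expR (- D) else b * expR (- D)).
apply: (@le_trans _ _ (expect p g)).
  apply: prob_markov => // [x|x dense_x].
    by apply: prodr_ge0 => i _; case: ifP => _; rewrite mulr_ge0 ?expR_ge0 // ltW.
  move: gamma_le1; rewrite le_eqVlt => /orP[/eqP gamma1|gamma_lt1].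
    have /finset.setIidPr xJ : J \subset x.
      move: dense_x; rewrite gamma1 mul1r ler_nat => le_J.
      have /eqP <- : x :&: J == J by rewrite eqEcard finset.subsetIr.
      exact: finset.subsetIl.
    rewrite /g big1 // => i iJ.
    have -> : i \in x by move: iJ; rewrite -xJ inE => /andP[].
    by rewrite /D /bernoulli_kl /a gamma1 ltxx expRN lnK ?posrE ?divr_gt0 //
      mulfV ?gt_eqF ?divr_gt0.
  have b_gt0 : 0 < b by rewrite divr_gt0 ?subr_gt0.
  have -> : g x = expR (\sum_(i in J) ((ln b - D) + (i \in x)%:R * (ln a - ln b))).
    rewrite expR_sum; apply: eq_bigr => i _; case: (i \in x) => /=.
      have -> : ln b - D + 1 * (ln a - ln b) = ln a - D by ring.
      by rewrite expRD lnK.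
    by rewrite mul0r addr0 expRD lnK.
  rewrite -[leLHS]expR0 ler_expR big_split /= sumr_const -mulr_suml -natr_sum.
  rewrite -big_mkcondr sum1_card.
  have -> : #|[pred i in J | i \in x]| = #|x :&: J|.
    by apply: eq_card => i; rewrite !inE andbC.
  have lab : 0 <= ln a - ln b by rewrite subr_ge0 ler_ln.
  rewrite -mulr_natr; have := ler_wpM2r lab dense_x.
  have -> : D = gamma * ln a + (1 - gamma) * ln b by rewrite /D bernoulli_klE // ltW.
  lra.
rewrite expect_prod -mulNr.
have -> : expR (- D * #|J|%:R) = \prod_(i in J) expR (- D).
  by rewrite prodr_const expRM_natr.
apply: ler_prod => i iJ; have /andP[pi0 pi1] := p01 i.
apply/andP; split.
  have a_e := mulr_ge0 (ltW a_gt0) (expR_ge0 (- D)).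
  have b_e := mulr_ge0 b_ge0 (expR_ge0 (- D)).
  by apply: addr_ge0; [exact: mulr_ge0 | rewrite mulr_ge0 ?subr_ge0].
rewrite [p i * _]mulrA [(1 - p i) * _]mulrA -mulrDl ler_piMl ?expR_ge0 //.
have ab1 : p1 * a + (1 - p1) * b = 1.
  by rewrite /a /b [p1 * _]mulrC [(1 - p1) * _]mulrC !divfK ?gt_eqF //; lra.
have ba : 0 <= a - b by rewrite subr_ge0.
have := ler_wpM2r ba (pJ i iJ); clearbody a b.
lra.
Qed.

End UpperTail.
(** * Vertex pairs and dense vertex sets *)

Lemma sum_subsets (R : comRingType) (T : finType) (U : {set T}) (a : R) :
  \sum_(S : {set T} | S \subset U) a ^+ #|S| = (1 + a) ^+ #|U|.
Proof.
have -> : (1 + a) ^+ #|U| = \prod_i ((if i \in U then a else 0) + 1).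
  rewrite -prodr_const big_mkcond; apply: eq_bigr => i _ /=.
  by case: ifP; rewrite ?add0r // addrC.
rewrite bigA_distr big_mkcond; apply: eq_bigr => S _ /=.
case: (boolP (S \subset U)) => [SU|/fintype.subsetPn[i iS iU]].
  rewrite -prodr_const big_mkcond; apply: eq_bigr => i _.
  by case: ifP => // /(fintype.subsetP SU) ->.
by rewrite (bigD1 i) //= iS (negPf iU) mul0r.
Qed.

Section PairsIn.
Variable n : nat.
Implicit Types (S T : {set 'I_n}).

Definition pairs_in S : {set 'I_n * 'I_n} :=
  [set ij in vertex_pairs n | (ij.1 \in S) && (ij.2 \in S)]%SET.

Lemma pairs_inS S T : S \subset T -> pairs_in S \subset pairs_in T.
Proof.
move=> /fintype.subsetP ST; apply/fintype.subsetP => ij; rewrite !inE.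
by move=> /and3P[-> /ST-> /ST->].
Qed.

Lemma pairs_inI S T : pairs_in (S :&: T)%SET = (pairs_in S :&: pairs_in T)%SET.
Proof.
apply/setP => ij; rewrite !inE.
by case: (_ < _)%N => //=; case: (ij.1 \in S); case: (ij.2 \in S);
  case: (ij.1 \in T); case: (ij.2 \in T).
Qed.

Lemma card_pairs_in S : #|pairs_in S| = 'C(#|S|, 2).
Proof.
rewrite -cards_draws.
have <- : [set [set ij.1; ij.2] | ij in pairs_in S]%SET =
          [set A : {set 'I_n} | A \subset S & #|A| == 2]%SET.
  apply/setP => A; rewrite inE; apply/imsetP/andP => [[[i j]]|[AS /cards2P[i [j [ij Aij]]]]].
    rewrite !inE /= => /and3P[ij iS jS] ->; split.
      by apply/fintype.subsetP => k; rewrite !inE => /orP[]/eqP->.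
    by rewrite cards2 -val_eqE /= neq_ltn ij.
  have iS : i \in S by rewrite (fintype.subsetP AS) // Aij !inE eqxx.
  have jS : j \in S by rewrite (fintype.subsetP AS) // Aij !inE eqxx orbT.
  move: ij; rewrite -val_eqE /= neq_ltn => /orP[ij|ij].
    by exists (i, j) => //; rewrite !inE /= ij iS.
  by exists (j, i); rewrite ?inE /= ?ij ?iS ?jS // Aij finset.setUC.
rewrite card_in_imset // => -[i j] [k l]; rewrite !inE /=.
move=> /and3P[ij _ _] /and3P[kl _ _] /setP eq_sets.
have := eq_sets i; have := eq_sets j; have := eq_sets k; rewrite !inE !eqxx /= ?orbT.
move=> /orP[]/eqP ek; move=> /esym/orP[]/eqP ej; move=> /esym/orP[]/eqP ei; subst => //;
  try by rewrite ltnn in ij.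
all: by move: (ltn_trans ij kl); rewrite ltnn.
Qed.

End PairsIn.

Definition dense_on (R : realType) (gamma : R) (n : nat) (S : {set 'I_n})
    (x : {set 'I_n * 'I_n}) : bool :=
  gamma * 'C(#|S|, 2)%:R <= #|(x :&: pairs_in S)%SET|%:R.

Lemma bin2_natr (R : realType) (s : nat) :
  'C(s, 2)%:R = s%:R * (s%:R - 1) / 2 :> R.
Proof.
elim: s => [|s IHs]; first by rewrite bin0n mul0r mul0r.
by rewrite binS bin1 natrD IHs -natr1; field.
Qed.
(** A union bound over all sets of size above s0.  For those the Chernoff
    bound is at most rho ^+ #|S| with rho = exp (- D (s0 - 1) / 2), and the sum
    of rho ^+ #|S| over all nonempty S is (1 + rho) ^+ n - 1. *)
Lemma prob_large_dense (R : realType) (gamma p1 s0 : R) (n : nat)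
    (p : 'I_n * 'I_n -> R) :
  0 < p1 -> p1 < gamma -> gamma <= 1 -> (forall ij, 0 <= p ij <= 1) ->
  (forall ij, ij \in vertex_pairs n -> p ij <= p1) -> 0 <= s0 ->
  prob p (fun x => [exists S : {set 'I_n}, (s0 < #|S|%:R) && dense_on gamma S x])
    <= expR (n%:R * expR (- (bernoulli_kl gamma p1 * (s0 - 1) / 2))) - 1.
Proof.
move=> p1_gt0 p1_lt gamma_le1 p01 p_le s0_ge0.
set D := bernoulli_kl gamma p1; set rho := expR (- (D * (s0 - 1) / 2)).
have D0 : 0 < D by exact: bernoulli_kl_gt0.
have rho0 : 0 < rho by exact: expR_gt0.
apply: (@le_trans _ _ (\sum_(S : {set 'I_n} | s0 < #|S|%:R) prob p (dense_on gamma S))).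
  by apply: prob_union => // x /existsP[S /andP[? ?]]; exists S.
apply: (@le_trans _ _ (\sum_(S : {set 'I_n} | s0 < #|S|%:R) rho ^+ #|S|)).
  apply: ler_sum => S s0S; rewrite /dense_on -card_pairs_in.
  apply: (le_trans (upper_tail p1_gt0 p1_lt gamma_le1 p01 _)).
    by move=> ij; rewrite inE => /andP[/p_le].
  rewrite -expRM_natr ler_expR card_pairs_in bin2_natr -/D.
  have : 0 <= D * (#|S|%:R - s0) * #|S|%:R.
    by rewrite !mulr_ge0 ?(ltW D0) // subr_ge0 ltW.
  lra.
have := sum_subsets [set: 'I_n] rho.
rewrite cardsT card_ord (bigD1 finset.set0) ?finset.sub0set //= cards0 expr0 => sum_eq.
have {sum_eq}sum_eq : \sum_(S : {set 'I_n} | (S \subset [set: 'I_n]%SET) && (S != finset.set0))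
    rho ^+ #|S| = (1 + rho) ^+ n - 1 by rewrite -sum_eq; ring.
apply: (@le_trans _ _ ((1 + rho) ^+ n - 1)).
  rewrite -sum_eq big_mkcond [leRHS]big_mkcond /=; apply: ler_sum => S _.
  rewrite finset.subsetT /=; case: ifP => [s0S|_]; case: eqP => [S0|_] //=.
    by move: s0S; rewrite S0 cards0 ltNge s0_ge0.
  by rewrite exprn_ge0 // ltW.
rewrite lerD2r expRM_natl lerXn2r ?nnegrE ?expR_ge0 ?expR_ge1Dx //.
by rewrite addr_ge0 // ltW.
Qed.

(** * The second moment method *)

(** The quotient of the two binomial coefficients is the product of the l
    fractions (k - i) / (m - i), each at most k / m. *)
Lemma bin_sub_le (m k l : nat) : (l <= k)%N -> (k <= m)%N ->
  ('C(m - l, k - l) * m ^ l <= 'C(m, k) * k ^ l)%N.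
Proof.
move=> + km; elim: l => [|l IHl] lk; first by rewrite !subn0 !expn0.
have ml : (0 < m - l)%N by rewrite subn_gt0 (leq_trans lk).
have kl : (0 < k - l)%N by rewrite subn_gt0.
have := mul_bin_diag (m - l) (k - l).-1; rewrite prednK // -!subnS => diag.
rewrite -(leq_pmul2l ml) mulnA diag expnS.
apply: (@leq_trans ((m - l) * ('C(m - l, k - l) * k * m ^ l))).
  have -> : ((k - l) * 'C(m - l, k - l) * (m * m ^ l) =
            ((k - l) * m) * ('C(m - l, k - l) * m ^ l))%N.
    by rewrite -!mulnA; congr (_ * _)%N; rewrite mulnCA.
  have -> : ((m - l) * ('C(m - l, k - l) * k * m ^ l) =
            ((m - l) * k) * ('C(m - l, k - l) * m ^ l))%N.
    by rewrite -!mulnA; congr (_ * _)%N; rewrite mulnCA.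
  rewrite leq_mul2r; apply/orP; right.
  by rewrite !mulnBl [(k * m)%N]mulnC leq_sub2l // leq_mul2l km orbT.
rewrite leq_mul2l; apply/orP; right.
rewrite expnS mulnAC [leqRHS]mulnCA [leqRHS]mulnC leq_mul2r.
by rewrite IHl ?orbT // ltnW.
Qed.

Section SecondMoment.
Variables (R : realType) (T : finType) (A : {set T}) (k : nat).
Hypotheses (A_gt0 : (0 < #|A|)%N) (k_le : (k <= #|A|)%N).

Let ksets := [set S : {set T} | S \subset A & #|S| == k]%SET.

Lemma card_ksets_above (B : {set T}) : B \subset A -> (#|B| <= k)%N ->
  #|[set S in ksets | B \subset S]%SET|%:R <=
  'C(#|A|, k)%:R * (k%:R / #|A|%:R) ^+ #|B| :> R.
Proof.
move=> BA Bk.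
have le_bin : (#|[set S in ksets | B \subset S]%SET| <= 'C(#|A| - #|B|, k - #|B|))%N.
  have <- : #|(A :\: B)%SET| = (#|A| - #|B|)%N.
    by rewrite cardsD (finset.setIidPr BA).
  rewrite -cards_draws.
  rewrite -(card_in_imset (f := fun S : {set T} => S :\: B)%SET); last first.
    move=> S S'; rewrite !inE => /andP[_ BS] /andP[_ BS'] eqD.
    by rewrite -(finset.setID S B) -(finset.setID S' B) eqD
      (finset.setIidPr BS) (finset.setIidPr BS').
  apply: subset_leq_card; apply/fintype.subsetP => _ /imsetP[S + ->].
  rewrite !inE => /andP[/andP[SA /eqP Sk] BS].
  by rewrite finset.setSD // cardsD (finset.setIidPr BS) Sk eqxx.
have := bin_sub_le Bk k_le => le_pow.
have A0 : 0 < #|A|%:R :> R by rewrite ltr0n.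
rewrite expr_div_n mulrA ler_pdivlMr ?exprn_gt0 // -!natrX -!natrM ler_nat.
by apply: leq_trans le_pow; rewrite leq_mul2r le_bin orbT.
Qed.

(** Write rho ^+ #|S :&: S'| as the sum of (rho - 1) ^+ #|B| over the common
    subsets B and count, for each B, the sets S' that contain it: up to the
    factor 'C(#|A|, k) there are at most (k / #|A|) ^+ #|B| of them. *)
Lemma sum_overlap (S : {set T}) (rho : R) : S \in ksets -> 1 <= rho ->
  \sum_(S' in ksets) rho ^+ #|(S :&: S')%SET| <=
  'C(#|A|, k)%:R * expR (rho * k%:R ^+ 2 / #|A|%:R).
Proof.
rewrite inE => /andP[SA /eqP Sk] rho1.
have A0 : 0 < #|A|%:R :> R by rewrite ltr0n.
have rho1' : 0 <= rho - 1 by rewrite subr_ge0.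
have -> : \sum_(S' in ksets) rho ^+ #|(S :&: S')%SET| =
    \sum_(B : {set T} | B \subset S)
      (rho - 1) ^+ #|B| * #|[set S' in ksets | B \subset S']%SET|%:R.
  transitivity (\sum_(S' in ksets) \sum_(B : {set T} | B \subset S)
      (if B \subset S' then (rho - 1) ^+ #|B| else 0)).
    apply: eq_bigr => S' _; rewrite -big_mkcondr.
    have := sum_subsets (S :&: S')%SET (rho - 1).
    rewrite [1 + _]addrC subrK => <-; apply: eq_bigl => B.
    by rewrite finset.subsetI.
  rewrite exchange_big; apply: eq_bigr => B _ /=.
  rewrite -big_mkcondr mulr_natr -sumr_const; apply: eq_bigl => S'.
  by rewrite !inE.
apply: (@le_trans _ _ (\sum_(B : {set T} | B \subset S)
    'C(#|A|, k)%:R * ((rho - 1) * (k%:R / #|A|%:R)) ^+ #|B|)).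
  apply: ler_sum => B BS; rewrite exprMn mulrCA ler_wpM2l ?exprn_ge0 //.
  apply: card_ksets_above; first exact: fintype.subset_trans SA.
  by rewrite -Sk subset_leq_card.
rewrite -mulr_sumr sum_subsets Sk ler_wpM2l //.
apply: (@le_trans _ _ (expR (rho * k%:R / #|A|%:R) ^+ k)).
  rewrite lerXn2r ?nnegrE ?expR_ge0 //.
    by rewrite addr_ge0 // mulr_ge0 // divr_ge0.
  apply: (le_trans (expR_ge1Dx _)); rewrite ler_expR mulrA.
  by rewrite ler_pM2r ?invr_gt0 // ler_wpM2r // lerBlDr lerDl.
rewrite -expRM_natr ler_expR le_eqVlt; apply/orP; left; apply/eqP; field.
exact: lt0r_neq0.
Qed.

End SecondMoment.
(** The second moment method for Z, the sum over the good k-subsets S of A of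
    the likelihood ratio of the pairs in S.  The mean of each term is the
    probability that S is good under the law tilted in S, at least 1 - tau.
    In the mean of Z ^+ 2, the product of the ratios of S and S' is the ratio
    of the union of their pairs, which has mean 1, times the ratio of the
    pairs in S :&: S', which goodness bounds by rho ^+ #|S :&: S'|. *)
Lemma prob_no_good_set (R : realType) (n : nat) (p : 'I_n * 'I_n -> R)
    (A : {set 'I_n}) (k : nat) (q rho tau : R)
    (good : {set 'I_n} -> pred {set 'I_n * 'I_n}) :
  (0 < #|A|)%N -> (k <= #|A|)%N -> 0 <= q <= 1 -> 1 <= rho -> tau < 1 ->
  (forall ij, 0 <= p ij <= 1) ->
  (forall ij, ij \in pairs_in A -> 0 < p ij < 1) ->
  (forall S : {set 'I_n}, S \subset A -> #|S| = k ->
    prob (tilt p q (pairs_in S)) (predC (good S)) <= tau) ->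
  (forall (S B : {set 'I_n}) x, S \subset A -> good S x -> B \subset S ->
    likelihood p q (pairs_in B) x <= rho ^+ #|B|) ->
  prob p (fun x => ~~ [exists S : {set 'I_n},
                         [&& S \subset A, #|S| == k & good S x]])
    <= expR (rho * k%:R ^+ 2 / #|A|%:R) / (1 - tau) ^+ 2 - 1.
Proof.
move=> A_gt0 k_le q01 rho1 tau1 p01 pA good_prob good_lik.
pose ksets := [set S : {set 'I_n} | S \subset A & #|S| == k]%SET.
pose C : R := 'C(#|A|, k)%:R.
have C0 : 0 < C by rewrite ltr0n bin_gt0.
pose lik (S : {set 'I_n}) x := likelihood p q (pairs_in S) x.
have pS (S : {set 'I_n}) : S \subset A -> forall ij, ij \in pairs_in S -> 0 < p ij < 1.
  by move=> SA ij /(fintype.subsetP (pairs_inS SA)) /pA.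
have lik0 (S : {set 'I_n}) x : S \subset A -> 0 <= lik S x.
  by move=> /pS SA; apply: likelihood_ge0.
pose Z x := \sum_(S in ksets) lik S x * (good S x)%:R.
have card_ksets : #|ksets| = 'C(#|A|, k) by rewrite cards_draws.
have mean_ge : C * (1 - tau) <= expect p Z.
  rewrite /Z expect_sum.
  have -> : C * (1 - tau) = \sum_(S in ksets) (1 - tau).
    by rewrite sumr_const card_ksets -mulr_natr mulrC.
  apply: ler_sum => S; rewrite inE => /andP[SA /eqP Sk].
  rewrite expect_likelihood; last exact: pS.
  rewrite -[leRHS]/(prob (tilt p q (pairs_in S)) (good S)) probC lerD2l lerN2.
  exact: good_prob.
have mean_gt0 : 0 < expect p Z.
  by apply: lt_le_trans mean_ge; rewrite mulr_gt0 ?subr_gt0.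
have Z2_le : expect p (fun x => Z x ^+ 2) <=
    C ^+ 2 * expR (rho * k%:R ^+ 2 / #|A|%:R).
  pose bound (S S' : {set 'I_n}) x := rho ^+ #|(S :&: S')%SET| *
    (likelihood p q (pairs_in S :|: pairs_in S')%SET x * 1).
  apply: (@le_trans _ _ (expect p (fun x =>
      \sum_(S in ksets) \sum_(S' in ksets) bound S S' x))).
    apply: le_expect => // x; rewrite expr2 /Z mulr_suml; apply: ler_sum => S.
    rewrite inE => /andP[SA _]; rewrite mulr_sumr; apply: ler_sum => S'.
    rewrite inE => /andP[S'A _]; rewrite /bound mulr1.
    have lik_U0 : 0 <= likelihood p q (pairs_in S :|: pairs_in S')%SET x.
      apply: likelihood_ge0 => // ij; rewrite finset.in_setU.
      by move=> /orP[/(pS _ SA)|/(pS _ S'A)].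
    case: (boolP (good S x)) => [good_S|_]; last first.
      by rewrite mulr0 mul0r mulr_ge0 // exprn_ge0 // (le_trans _ rho1).
    apply: (@le_trans _ _ (lik S x * lik S' x)).
      rewrite mulr1 ler_wpM2l ?lik0 // ler_piMr ?lik0 //.
      by case: (good S' x).
    rewrite /lik likelihoodU -pairs_inI mulrC ler_wpM2r //.
    by apply: (good_lik S) => //; exact: finset.subsetIl.
  rewrite expect_sum expr2 -mulrA.
  have -> : C * (C * expR (rho * k%:R ^+ 2 / #|A|%:R)) =
      \sum_(S in ksets) (C * expR (rho * k%:R ^+ 2 / #|A|%:R)).
    by rewrite sumr_const card_ksets -[RHS]mulr_natl.
  apply: ler_sum => S Sk; apply: le_trans (sum_overlap A_gt0 k_le Sk rho1).
  rewrite expect_sum; apply: ler_sum => S' S'k.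
  rewrite expectZ expect_likelihood; last first.
    move: Sk S'k; rewrite !inE => /andP[SA _] /andP[S'A _] ij.
    by rewrite finset.in_setU => /orP[/(pS _ SA)|/(pS _ S'A)].
  rewrite /expect; under eq_bigr do rewrite mulr1.
  by rewrite sum_config_mass mulr1.
have := prob_second_moment Z p01.
set P0 := prob p _ => P0_le.
apply: (@le_trans _ _ P0).
  apply: prob_markov => // x no_good; suff -> : Z x == 0 by [].
  apply/eqP/big1 => S; rewrite inE => /andP[SA Sk].
  move: no_good; rewrite negb_exists => /forallP/(_ S); rewrite SA Sk /= => /negPf->.
  by rewrite mulr0.
set E := expR _ in Z2_le *.
have tau0 : 0 < (1 - tau) ^+ 2 by rewrite exprn_gt0 // subr_gt0.
have m2 : 0 < expect p Z ^+ 2 by rewrite exprn_gt0.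
apply: (@le_trans _ _ (C ^+ 2 * E / expect p Z ^+ 2 - 1)).
  rewrite lerBrDr ler_pdivlMr // mulrDl mul1r.
  by apply: le_trans Z2_le; rewrite -lerBrDr.
rewrite lerD2r ler_pdivlMr // mulrAC ler_pdivrMr //.
rewrite mulrAC [leRHS]mulrC; apply: ler_wpM2r; first exact: expR_ge0.
rewrite -exprMn lerXn2r ?nnegrE ?(ltW mean_gt0) //.
by rewrite mulr_ge0 ?(ltW C0) // subr_ge0 ltW.
Qed.
(** A set S is good when it is dense and the likelihood ratio of the pairs in
    every subset B is at most exp (sigma #|B|).  Failure of the second
    condition for some B is rare under the tilted law.  For small B it is
    impossible, because each pair contributes a factor of at most exp b.  For
    the other B the size is at least of order sigma / b, so [likelihood_tail]
    bounds the probability by the exponential of a negative multiple of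
    sigma ^+ 2; this outweighs the number 2 ^+ k of subsets when sigma is of
    the order of k and both are large.  The condition relating
    kl, k and sigma puts exp (kl 'C(#|B|, 2)), the bound in that lemma, below
    the one allowed for B, even for B = S. *)
Lemma prob_no_dense_set (R : realType) (gamma p0 p1 q kl : R) :
  0 < p0 -> p1 < 1 -> 0 < q <= 1 -> gamma < q \/ (q = 1 /\ gamma <= 1) ->
  0 < kl -> q * ln (q / p0) + (1 - q) * ln ((1 - q) / (1 - p1)) < kl ->
  exists r b : R, [/\ 0 < r < 1, 0 < b &
  forall (n : nat) (p : 'I_n * 'I_n -> R) (A : {set 'I_n}) (k : nat)
    (sigma tau : R),
    (0 < #|A|)%N -> (k <= #|A|)%N -> (forall ij, 0 <= p ij <= 1) ->
    (forall ij, ij \in pairs_in A -> p0 <= p ij <= p1) ->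
    0 <= sigma -> kl * (k%:R - 1) / 2 <= sigma ->
    r ^+ 'C(k, 2) + 2 ^+ k * expR (ln r * (2 * (sigma / b) ^+ 2)) <= tau ->
    tau < 1 ->
    prob p (fun x => ~~ [exists S : {set 'I_n},
                          [&& S \subset A, #|S| == k & dense_on gamma S x]])
      <= expR (expR sigma * k%:R ^+ 2 / #|A|%:R) / (1 - tau) ^+ 2 - 1].
Proof.
move=> p0_gt0 p1_lt1 q01' gamma_q kl0 kl_gt.
have /andP[q0 q1] := q01'; have q01 : 0 <= q <= 1 by rewrite (ltW q0).
have [r1 /andP[r1_gt0 r1_lt1] r1_tail] := lower_tail q01 gamma_q.
have [r2 /andP[r2_gt0 r2_lt1] r2_tail] := likelihood_tail q01' p0_gt0 p1_lt1 kl_gt.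
pose r := Num.max r1 r2.
have r_gt0 : 0 < r by rewrite lt_max r1_gt0.
have r_lt1 : r < 1 by rewrite gt_max r1_lt1.
have p1'0 : 0 < 1 - p1 by rewrite subr_gt0.
pose b : R := p0^-1 + (1 - p1)^-1.
have b0 : 0 < b by rewrite addr_gt0 ?invr_gt0.
exists r, b; split=> //; first by rewrite r_gt0.
move=> n p A k sigma tau A_gt0 k_le p01 pA sigma0 kl_le tau_ge tau_lt1.
pose good (S : {set 'I_n}) (x : {set 'I_n * 'I_n}) := dense_on gamma S x &&
  [forall B : {set 'I_n}, (B \subset S) ==>
     (likelihood p q (pairs_in B) x <= expR sigma ^+ #|B|)].
have pA01 ij : ij \in pairs_in A -> 0 < p ij < 1.
  move=> /pA/andP[pge ple]; rewrite (lt_le_trans p0_gt0 pge).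
  exact: le_lt_trans p1_lt1.
have main := @prob_no_good_set R n p A k q (expR sigma) tau good
  A_gt0 k_le q01 _ tau_lt1 p01 pA01 _ _.
apply: le_trans (main _ _ _).
- apply: prob_le => // x; apply: contra => /existsP[S /and3P[SA Sk /andP[dS _]]].
  by apply/existsP; exists S; rewrite SA Sk.
- by rewrite -[leLHS]expR0 ler_expR.
- move=> S SA Sk; apply: le_trans tau_ge.
  have tilt_01 := tilt01 (pairs_in S) p01 q01.
  pose heavy (B : {set 'I_n}) x :=
    expR sigma ^+ #|B| < likelihood p q (pairs_in B) x.
  apply: (le_trans (@prob_le_add _ _ _ _ (predC (dense_on gamma S))
      (fun x => [exists B : {set 'I_n}, (B \subset S) && heavy B x]) tilt_01 _)).
    move=> x; rewrite /= negb_and => /orP[->//|].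
    rewrite negb_forall => /existsP[B]; rewrite negb_imply -ltNge => heavyB.
    by apply/orP; right; apply/existsP; exists B.
  apply: lerD.
    have -> : 'C(k, 2) = #|pairs_in S| by rewrite card_pairs_in Sk.
    apply: (@le_trans _ _ (r1 ^+ #|pairs_in S|)); last first.
      by rewrite lerXn2r ?nnegrE ?(ltW r1_gt0) ?(ltW r_gt0) // le_max lexx.
    apply: le_trans (r1_tail _ (tilt p q (pairs_in S)) (pairs_in S) tilt_01 _).
      by apply: prob_le => // x /=; rewrite /dense_on -ltNge card_pairs_in.
    by move=> ij ijS; rewrite /tilt ijS.
  apply: (@le_trans _ _ (\sum_(B : {set 'I_n} | B \subset S)
      expR (ln r * (2 * (sigma / b) ^+ 2)))).
    apply: (le_trans (@prob_union _ _ _ _ (fun B : {set 'I_n} => B \subset S) _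
      heavy tilt_01 _)).
      by move=> x /existsP[B /andP[BS hB]]; exists B.
    apply: ler_sum => B BS.
    have BA := fintype.subset_trans BS SA.
    have B_le : #|B|%:R <= k%:R :> R by rewrite ler_nat -Sk subset_leq_card.
    have expB : expR sigma ^+ #|B| = expR (sigma * #|B|%:R) by rewrite expRM_natr.
    case: (leP (b * (#|B|%:R - 1) / 2) sigma) => [small|large].
      rewrite /prob /expect big1 ?expR_ge0 // => x _.
      suff -> : heavy B x = false by rewrite mulr0.
      apply/negbTE; rewrite /heavy -leNgt.
      apply: (@le_trans _ _ (\prod_(ij in pairs_in B) expR b)).
        apply: ler_prod => ij ijB.
        have ijA : ij \in pairs_in A by rewrite (fintype.subsetP (pairs_inS BA)).
        have /andP[pge ple] := pA ij ijA; have /andP[pgt plt] := pA01 ij ijA.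
        have p'0 : 0 < 1 - p ij by rewrite subr_gt0.
        have b_le : b <= expR b.
          by apply: le_trans (expR_ge1Dx _); rewrite lerDr.
        case: ifP => _; apply/andP; split.
        + by rewrite divr_ge0 // ltW.
        + apply: le_trans b_le; apply: (@le_trans _ _ p0^-1); last first.
            by rewrite lerDl invr_ge0 ltW.
          apply: (@le_trans _ _ (p ij)^-1); last by rewrite lef_pV2.
          by rewrite ler_piMl // invr_ge0 ltW.
        + by rewrite divr_ge0 ?subr_ge0 // ltW.
        + apply: le_trans b_le; apply: (@le_trans _ _ (1 - p1)^-1); last first.
            by rewrite lerDr invr_ge0 ltW.
          apply: (@le_trans _ _ (1 - p ij)^-1); last by rewrite lef_pV2 // lerD2l lerN2.
          by rewrite ler_piMl ?invr_ge0 ?(ltW p'0) // lerBlDr lerDl ltW.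
      rewrite prodr_const expB -expRM_natr ler_expR card_pairs_in bin2_natr.
      have := ler_wpM2r (ler0n R #|B|) small; lra.
    apply: (@le_trans _ _ (r2 ^+ #|pairs_in B|)).
      apply: le_trans (r2_tail _ p (pairs_in S) (pairs_in B) p01 _ (pairs_inS BS)).
        apply: prob_le => // x; rewrite /heavy; apply: le_lt_trans.
        rewrite expB ler_expR card_pairs_in bin2_natr.
        have kB : kl * (#|B|%:R - 1) / 2 <= sigma.
          apply: le_trans kl_le; rewrite ler_pM2r ?invr_gt0 //.
          by rewrite ler_pM2l // lerD2r.
        have := ler_wpM2r (ler0n R #|B|) kB; lra.
      by move=> ij /(fintype.subsetP (pairs_inS SA)) /pA.
    apply: (@le_trans _ _ (r ^+ #|pairs_in B|)).
      by rewrite lerXn2r ?nnegrE ?(ltW r2_gt0) ?(ltW r_gt0) // le_max lexx orbT.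
    rewrite -{1}[r]lnK ?posrE // -expRM_natr ler_expR.
    have ln_r : ln r < 0 by rewrite -ln1 ltr_ln ?posrE.
    rewrite ler_nM2l // card_pairs_in bin2_natr.
    have sb : 0 <= sigma / b by rewrite divr_ge0 // ltW.
    have : sigma / b < (#|B|%:R - 1) / 2.
      by rewrite ltr_pdivrMr // mulrC mulrA.
    set z := #|B|%:R; set w := sigma / b => wz.
    have w2 : w ^+ 2 <= ((z - 1) / 2) ^+ 2.
      rewrite lerXn2r ?nnegrE ?sb ?(ltW wz) //.
      exact: le_trans (ltW wz).
    apply: (@le_trans _ _ (2 * ((z - 1) / 2) ^+ 2)); first by rewrite ler_pM2l.
    have z1 : 0 <= z - 1 by move: wz sb; rewrite -/w; lra.
    rewrite expr2; lra.
  rewrite (eq_bigr (fun B : {set 'I_n} =>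
      expR (ln r * (2 * (sigma / b) ^+ 2)) * 1 ^+ #|B|)); last first.
    by move=> B _; rewrite expr1n mulr1.
  by rewrite -mulr_sumr sum_subsets Sk mulrC.
- move=> S B x SA /andP[_ /forallP/(_ B)/implyP]; exact.
Qed.
(** * Asymptotics *)

Section Asymptotics.
Variable R : realType.

(** Asymptotic statements in n are reduced to statements in y = ln n. *)
Lemma near_ln (P : R -> Prop) :
  (\forall y \near +oo, P y) -> \forall n \near \oo, P (ln n%:R).
Proof.
move=> [Y [_ YP]]; near=> n; apply: YP.
have n_gt : expR Y < n%:R by near: n; exact: nbhs_infty_gtr.
by rewrite -ltr_expR lnK // posrE (lt_trans (expR_gt0 Y)).
Unshelve. all: by end_near. Qed.

Lemma near_expR_le (c d nu : R) : 0 < c -> 0 < nu ->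
  \forall y \near +oo, expR (d - c * y) <= nu.
Proof.
move=> c0 nu0; near=> y.
rewrite -[leRHS]lnK ?posrE // ler_expR lerBlDr -lerBlDl -ler_pdivrMl //.
Unshelve. all: by end_near. Qed.

Lemma near_poly_expR_le (a c nu : R) : 0 < a -> 0 < c -> 0 < nu ->
  \forall y \near +oo, (a * y + 1) ^+ 2 * expR (- (c * y)) <= nu.
Proof.
move=> a0 c0 nu0; pose K : R := (a + 1) ^+ 2 / (c / 3) ^+ 3.
near=> y.
have y1 : 1 <= y by [].
have yK : K / nu <= y by [].
have y0 : 0 < y by lra.
have c3 : 0 < c / 3 by rewrite divr_gt0.
have e3 : (c / 3 * y) ^+ 3 <= expR (c * y).
  have -> : c * y = c / 3 * y * 3%:R by field.
  have cy0 : 0 <= c / 3 * y by rewrite ltW // mulr_gt0.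
  rewrite expRM_natr lerXn2r ?nnegrE ?expR_ge0 //.
  by apply: le_trans (expR_ge1Dx _); rewrite lerDr.
rewrite expRN ler_pdivrMr ?expR_gt0 //.
apply: le_trans (ler_wpM2l (ltW nu0) e3).
apply: (@le_trans _ _ (((a + 1) * y) ^+ 2)).
  have ay0 : 0 <= a * y by rewrite ltW // mulr_gt0.
  by rewrite lerXn2r ?nnegrE; lra.
rewrite ler_pdivrMr // in yK; move: yK.
rewrite /K ler_pdivrMr ?exprn_gt0 // => yK.
rewrite exprMn [(_ * y) ^+ 3]exprMn [y ^+ 3]exprS.
have := ler_wpM2r (sqr_ge0 y) yK.
move: ((c / 3) ^+ 3) ((a + 1) ^+ 2) (y ^+ 2) => u v w.
by have -> : nu * (u * (y * w)) = y * nu * u * w by ring.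
Unshelve. all: by end_near. Qed.

Lemma prob_large_dense_small (gamma p1 eps delta : R) :
  0 < p1 -> p1 < gamma -> gamma <= 1 -> 0 < eps -> 0 < delta ->
  \forall n \near \oo, forall p : 'I_n * 'I_n -> R,
    (forall ij, 0 <= p ij <= 1) ->
    (forall ij, ij \in vertex_pairs n -> p ij <= p1) ->
    prob p (fun x => [exists S : {set 'I_n},
      ((1 + eps) * typical_size gamma p1 n < #|S|%:R) && dense_on gamma S x])
    <= delta.
Proof.
move=> p1_gt0 p1_lt gamma_le1 eps0 delta0.
have D0 := bernoulli_kl_gt0 p1_gt0 p1_lt gamma_le1.
have nu0 : 0 < ln (1 + delta) by rewrite ln_gt0 // ltrDl.
have small := near_ln (near_expR_le (bernoulli_kl gamma p1 / 2) eps0 nu0).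
near=> n => p p01 ple.
have n0 : (0 < n)%N by near: n; exact: nbhs_infty_gt.
have n0' : 0 < n%:R :> R by rewrite ltr0n.
have ln0 : 0 <= ln n%:R :> R by rewrite ln_ge0 // ler1n.
have s0 : 0 <= (1 + eps) * typical_size gamma p1 n.
  by rewrite mulr_ge0 ?addr_ge0 ?(ltW eps0) // divr_ge0 ?mulr_ge0 // ltW.
apply: (le_trans (prob_large_dense p1_gt0 p1_lt gamma_le1 p01 ple s0)).
rewrite lerBlDl -[leRHS]lnK ?posrE ?addr_gt0 // ler_expR.
rewrite -{1}[n%:R]lnK ?posrE // -expRD.
have -> : ln n%:R + - (bernoulli_kl gamma p1 *
    ((1 + eps) * typical_size gamma p1 n - 1) / 2) =
    bernoulli_kl gamma p1 / 2 - eps * ln n%:R.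
  by rewrite /typical_size; field; exact: lt0r_neq0.
by near: n.
Unshelve. all: by end_near. Qed.

(** For gamma < 1 the tilt is to some q slightly above gamma, so that a set is
    dense with high probability under the tilted law; the divergence is
    continuous in q.  For gamma = 1 the tilted law makes S a clique, q = 1.
    Lowering p1 to p0 = p1 exp (- t) costs at most t in the divergence. *)
Lemma exists_tilt (gamma p1 K : R) : 0 < p1 -> p1 < gamma -> gamma <= 1 ->
  bernoulli_kl gamma p1 < K ->
  exists q p0 : R, [/\ 0 < q <= 1, gamma < q \/ (q = 1 /\ gamma <= 1),
    0 < p0 < p1 & q * ln (q / p0) + (1 - q) * ln ((1 - q) / (1 - p1)) < K].
Proof.
move=> p1_gt0 p1_lt gamma_le1 klK.
have gamma_gt0 : 0 < gamma by exact: lt_trans p1_lt.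
have p1_lt1 : p1 < 1 by exact: lt_le_trans gamma_le1.
suff [q [q01 gq qK]] : exists q : R, [/\ 0 < q <= 1,
    gamma < q \/ (q = 1 /\ gamma <= 1) &
    q * ln (q / p1) + (1 - q) * ln ((1 - q) / (1 - p1)) < K].
  have /andP[q0 q1] := q01.
  pose t := (K - (q * ln (q / p1) + (1 - q) * ln ((1 - q) / (1 - p1)))) / 2.
  have t0 : 0 < t by rewrite /t; lra.
  exists q, (p1 * expR (- t)); split => //.
    by rewrite mulr_gt0 ?expR_gt0 //= gtr_pMr // expR_lt1 oppr_lt0.
  have -> : ln (q / (p1 * expR (- t))) = ln (q / p1) + t.
    by rewrite invfM expRN invrK mulrA lnM ?posrE ?divr_gt0 ?expR_gt0 // expRK.
  have qt : q * t <= t by rewrite ler_piMl // ltW.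
  rewrite mulrDr; move: qt; rewrite /t; lra.
have /orP[/eqP gamma1|gamma_lt1] : (gamma == 1) || (gamma < 1) by rewrite -le_eqVlt.
  exists 1; split; [by rewrite ltr01 lexx|by right; split|].
  rewrite -bernoulli_klE //; move: klK; by rewrite gamma1.
pose f q : R := q * ln (q / p1) + (1 - q) * ln ((1 - q) / (1 - p1)).
have f_cont : f q @[q --> gamma] --> f gamma.
  have p1'0 : 0 < 1 - p1 by rewrite subr_gt0.
  have c1 : q / p1 @[q --> gamma] --> gamma / p1 by apply: cvgM; [exact: cvg_id|exact: cvg_cst].
  have c2 : (1 - q) / (1 - p1) @[q --> gamma] --> (1 - gamma) / (1 - p1).
    by apply: cvgM; [apply: cvgB; [exact: cvg_cst|exact: cvg_id]|exact: cvg_cst].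
  have l1 : ln (q / p1) @[q --> gamma] --> ln (gamma / p1).
    by apply: continuous_cvg c1; apply: continuous_ln; rewrite divr_gt0.
  have l2 : ln ((1 - q) / (1 - p1)) @[q --> gamma] --> ln ((1 - gamma) / (1 - p1)).
    by apply: continuous_cvg c2; apply: continuous_ln; rewrite divr_gt0 ?subr_gt0.
  apply: cvgD; [apply: cvgM l1; exact: cvg_id | apply: cvgM l2].
  by apply: cvgB; [exact: cvg_cst|exact: cvg_id].
have fK : f gamma < K by rewrite /f -bernoulli_klE // ltW.
have near_f : \forall q \near gamma^'+, f q < K.
  by exact: cvgr_lt (cvg_at_right_filter f_cont) _ fK.
near gamma^'+ => q.
exists q; have gq : gamma < q by near: q; exact: nbhs_right_gt.
have q1 : q <= 1 by near: q; exact: nbhs_right_le.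
split; [by rewrite (lt_trans gamma_gt0 gq)|by left|].
by near: q.
Unshelve. all: by end_near. Qed.

End Asymptotics.
(** The parameters for n vertices, with y = ln n and D the divergence, are
    k = floor (a y) + 1, where a y is 1 - eps times the typical size 2 y / D,
    and sigma = (1 - eps / 2) y.  With kl = D (1 + eps / 2) the product
    kl (k - 1) / 2 is at most (1 + eps / 2) (1 - eps) y, hence at most sigma,
    while exp sigma * k ^+ 2 / #|A| is of order y ^+ 2 exp (- eps y / 2). *)
Lemma prob_no_dense_small (R : realType) (gamma p1 eps : R) :
  0 < p1 -> p1 < gamma -> gamma <= 1 -> 0 < eps < 1 ->
  exists2 p0 : R, 0 < p0 < p1 & forall eta delta : R, 0 < eta -> 0 < delta ->
  \forall n \near \oo, forall (p : 'I_n * 'I_n -> R) (A : {set 'I_n}),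
    eta * n%:R <= #|A|%:R -> (forall ij, 0 <= p ij <= 1) ->
    (forall ij, ij \in pairs_in A -> p0 <= p ij <= p1) ->
    prob p (fun x => ~~ [exists S : {set 'I_n},
      ((1 - eps) * typical_size gamma p1 n <= #|S|%:R) && dense_on gamma S x])
    <= delta.
Proof.
move=> p1_gt0 p1_lt gamma_le1 /andP[eps0 eps1].
have p1_lt1 : p1 < 1 by exact: lt_le_trans gamma_le1.
set D := bernoulli_kl gamma p1.
have D0 : 0 < D by exact: bernoulli_kl_gt0.
pose kl := D * (1 + eps / 2).
have D_kl : D < kl by rewrite /kl ltr_pMr // ltrDl divr_gt0.
have kl0 : 0 < kl by exact: lt_trans D_kl.
have [q [p0 [q01 gamma_q p0p1 mean_lt]]] := exists_tilt p1_gt0 p1_lt gamma_le1 D_kl.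
have /andP[p0_gt0 p0_lt] := p0p1.
have [r [b [/andP[r0 r1] b0 main]]] :=
  prob_no_dense_set p0_gt0 p1_lt1 q01 gamma_q kl0 mean_lt.
exists p0 => // eta delta eta0 delta0.
have ln_r : ln r < 0 by rewrite -ln1 ltr_ln ?posrE.
(* nu bounds both the exponent and the failure probability tau. *)
have [nu [nu0 nu1 nu_le]] : exists nu : R,
    [/\ 0 < nu, nu < 1 & expR nu / (1 - nu) ^+ 2 - 1 <= delta].
  pose F nu : R := expR nu / (1 - nu) ^+ 2 - 1.
  have F_cont : F nu @[nu --> (0 : R)] --> F 0.
    apply: cvgB; last exact: cvg_cst.
    apply: cvgM; first exact: continuous_expR.
    apply: cvgV; first by rewrite subr0 expr1n oner_neq0.
    have c1 : 1 - nu @[nu --> (0 : R)] --> 1 - (0 : R).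
      by apply: cvgB; [exact: cvg_cst|exact: cvg_id].
    by rewrite expr2; exact: (cvgM c1 c1).
  have F0 : F 0 < delta by rewrite /F expR0 subr0 expr1n divr1 subrr.
  near (0 : R)^'+ => nu; exists nu; split.
  - by near: nu; exact: nbhs_right_gt.
  - by near: nu; exact: nbhs_right_lt.
  - rewrite ltW //; near: nu.
    exact: cvgr_lt (cvg_at_right_filter F_cont) _ F0.
pose a : R := (1 - eps) * 2 / D.
have a0 : 0 < a by rewrite divr_gt0 // mulr_gt0 // subr_gt0.
pose c : R := - ln r * 2 * ((1 - eps / 2) / b) ^+ 2.
have c0 : 0 < c.
  have d0 : 0 < (1 - eps / 2) / b by rewrite divr_gt0 // subr_gt0; lra.
  by rewrite /c mulr_gt0 ?exprn_gt0 // mulr_gt0 // oppr_gt0.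
have nu2 : 0 < nu / 2 by rewrite divr_gt0.
have eps2 : 0 < eps / 2 by rewrite divr_gt0.
have mineta : 0 < nu * eta by rewrite mulr_gt0.
have ra : 0 < - ln r * a by rewrite mulr_gt0 // oppr_gt0.
have near1 := near_ln (near_expR_le (- ln r) ra nu2).
have near2 := near_ln (near_expR_le 1 ltr01 nu2).
have near3 := near_ln (near_poly_expR_le a0 eps2 mineta).
have near4 := near_ln (nbhs_pinfty_ge (num_real ((a + 1) / c))).
near=> n => p A A_ge p01 pA.
have n0 : (0 < n)%N by near: n; exact: nbhs_infty_gt.
have n0' : 0 < n%:R :> R by rewrite ltr0n.
pose y : R := ln n%:R.
have y0 : 0 <= y by rewrite /y ln_ge0 // ler1n.
have ny : n%:R = expR y by rewrite lnK // posrE.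
have small1 : expR (- ln r - (- ln r * a) * y) <= nu / 2 by rewrite /y; near: n.
have small2 : expR (1 - 1 * y) <= nu / 2 by rewrite /y; near: n.
have small3 : (a * y + 1) ^+ 2 * expR (- (eps / 2 * y)) <= nu * eta by rewrite /y; near: n.
have y_ge : (a + 1) / c <= y by rewrite /y; near: n.
have ay0 : 0 <= a * y by rewrite mulr_ge0 // ltW.
have A0 : 0 < #|A|%:R :> R by apply: lt_le_trans A_ge; rewrite mulr_gt0.
pose k := (Num.truncn (a * y)).+1.
have /andP[k_le k_gt] := truncn_itv ay0.
have k_le' : k%:R <= a * y + 1 by rewrite /k -natr1 lerD2r.
pose sigma : R := (1 - eps / 2) * y.
have sigma0 : 0 <= sigma by rewrite mulr_ge0 //; lra.
have theta_le : expR sigma * k%:R ^+ 2 / #|A|%:R <= nu.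
  rewrite ler_pdivrMr //.
  apply: le_trans (ler_wpM2l (ltW nu0) A_ge).
  have -> : expR sigma * k%:R ^+ 2 = k%:R ^+ 2 * expR (- (eps / 2 * y)) * n%:R.
    rewrite ny -mulrA -expRD mulrC; congr (_ * expR _).
    by rewrite /sigma; ring.
  rewrite [nu * (_ * _)]mulrA ler_pM2r //.
  apply: le_trans small3; rewrite ler_wpM2r ?expR_ge0 //.
  by rewrite lerXn2r ?nnegrE // addr_ge0.
have k_leA : (k <= #|A|)%N.
  rewrite -(ler_nat R); move: theta_le; rewrite ler_pdivrMr // => theta_le.
  apply: le_trans (le_trans theta_le _); last by rewrite ler_piMl // ltW.
  apply: (@le_trans _ _ (k%:R ^+ 2)); first by rewrite -natrX ler_nat expnS leq_pmulr.
  by rewrite ler_peMl ?exprn_ge0 // -[leLHS]expR0 ler_expR.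
have kl_le : kl * (k%:R - 1) / 2 <= sigma.
  apply: (@le_trans _ _ (kl * (a * y) / 2)).
    by rewrite ler_pM2r // ler_pM2l // lerBlDr.
  (* (1 + eps / 2) (1 - eps) = 1 - eps / 2 - eps ^+ 2 / 2 *)
  have -> : kl * (a * y) / 2 = (1 - eps / 2 - eps ^+ 2 / 2) * y.
    by rewrite /kl /a; field; exact: lt0r_neq0.
  by rewrite /sigma ler_wpM2r // lerBlDr lerDl divr_ge0 ?sqr_ge0.
have tau_le : r ^+ 'C(k, 2) + 2 ^+ k * expR (ln r * (2 * (sigma / b) ^+ 2)) <= nu.
  rewrite [leRHS](splitr nu); apply: lerD.
    apply: le_trans small1; rewrite -{1}[r]lnK ?posrE // -expRM_natr ler_expR.
    have -> : - ln r - - ln r * a * y = ln r * (a * y - 1) by ring.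
    rewrite ler_nM2l // bin2_natr.
    have k1 : 1 <= k%:R :> R by rewrite ler1n.
    (* 'C(k, 2) >= k - 1 > a y - 1 *)
    have [k_eq1|k_gt1] := leqP k 1.
      have -> : k%:R = 1 :> R by apply/eqP; rewrite eq_le k1 andbT lern1.
      rewrite subrr mulr0 mul0r; have : k%:R <= 1 :> R by rewrite lern1.
      by move: k_gt; rewrite -/k; lra.
    have : 2%:R <= k%:R :> R by rewrite ler_nat.
    move=> k2; have : 0 <= (k%:R - 2) * (k%:R - 1) :> R.
      by rewrite mulr_ge0 // subr_ge0.
    by move: k_gt; rewrite -/k; lra.
  apply: le_trans small2.
  apply: (@le_trans _ _ (expR 1 ^+ k * expR (ln r * (2 * (sigma / b) ^+ 2)))).
    rewrite ler_wpM2r ?expR_ge0 // lerXn2r ?nnegrE ?expR_ge0 //.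
    by apply: le_trans (expR_ge1Dx _).
  rewrite -expRM_natr -expRD ler_expR mul1r.
  have -> : ln r * (2 * (sigma / b) ^+ 2) = - (c * y) * y.
    by rewrite /sigma /c; field; exact: lt0r_neq0.
  move: y_ge; rewrite ler_pdivrMr // [y * c]mulrC => y_ge.
  have := ler_wpM2r y0 y_ge; lra.
apply: le_trans nu_le.
apply: (@le_trans _ _ (expR (expR sigma * k%:R ^+ 2 / #|A|%:R) / (1 - nu) ^+ 2 - 1)); last first.
  rewrite lerD2r ler_pM2r ?ler_expR // invr_gt0 exprn_gt0 // subr_gt0 //.
have A0' : (0 < #|A|)%N by rewrite -(ltr_nat R).
apply: le_trans (main n p A k sigma nu A0' k_leA p01 pA sigma0 kl_le tau_le nu1).
apply: prob_le => // x; apply: contra => /existsP[S /and3P[_ /eqP Sk dS]].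
apply/existsP; exists S; rewrite dS andbT Sk.
have -> : (1 - eps) * typical_size gamma p1 n = a * y.
  by rewrite /typical_size -/D /a /y; field; exact: lt0r_neq0.
exact: ltW.
Unshelve. all: by end_near. Qed.
(** * From the random graph to products of Bernoulli measures *)

Lemma measurable_fin_forall (d : measure_display) (T : measurableType d)
    (K : finType) (Q : K -> set T) :
  (forall k, measurable (Q k)) -> measurable [set t | forall k, Q k t].
Proof.
move=> Qm; have -> : [set t | forall k, Q k t] = \bigcap_(k in [set: K]) Q k.
  by apply/seteqP; split=> t /= Qt k; [move=> _|]; exact: Qt.
by apply: fin_bigcap_measurable => //; exact: finite_finset.
Qed.

Lemma probability_fin_partition (R : realType) (d : measure_display)
    (T : measurableType d) (P : probability T R) (K : finType) (X : T -> K)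
    (E : pred K) :
  (forall x, measurable [set t | X t = x]) ->
  measurable [set t | E (X t)] /\
  P [set t | E (X t)] = (\sum_(x | E x) P [set t | X t = x])%E.
Proof.
move=> Xm.
suff seq_case (s : seq K) : uniq s -> measurable [set t | X t \in s] /\
    P [set t | X t \in s] = (\sum_(x <- s) P [set t | X t = x])%E.
  have [|] := seq_case [seq x <- enum K | E x]; first by rewrite filter_uniq ?enum_uniq.
  rewrite big_filter big_enum_cond.
  have -> // : [set t | X t \in [seq x <- enum K | E x]] = [set t | E (X t)].
  by apply/seteqP; split => t /=; rewrite mem_filter mem_enum andbT.
elim: s => [_|x s IHs /= /andP[xs /IHs[sm Ps]]].
  have -> : [set t | X t \in [::]] = set0 by apply/seteqP; split.
  by rewrite measure0 big_nil; split.
have -> : [set t | X t \in x :: s] = [set t | X t = x] `|` [set t | X t \in s].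
  by apply/seteqP; split => t /=; rewrite in_cons => /predU1P.
split; first exact: measurableU.
rewrite big_cons -Ps measureU //.
by apply/seteqP; split => t //= [-> /(negP xs)].
Qed.

Definition edge_set (n : nat) (e : rel 'I_n) : {set 'I_n * 'I_n} :=
  [set ij in vertex_pairs n | e ij.1 ij.2]%SET.

Lemma in_edge_set (n : nat) (e : rel 'I_n) ij :
  (ij \in edge_set e) = (ij \in vertex_pairs n) && e ij.1 ij.2.
Proof. by rewrite /edge_set finset.in_set. Qed.

Lemma quasi_clique_dense (R : realType) (gamma : R) (n : nat) (e : rel 'I_n)
    (S : {set 'I_n}) : quasi_clique gamma e S = dense_on gamma S (edge_set e).
Proof.
rewrite /quasi_clique /dense_on; congr (_ <= _%:R); apply: eq_card => ij.
by rewrite !inE; case: (_ < _)%N => //=; case: (e _ _); rewrite ?andbF ?andbT.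
Qed.

(** Giving probability 0 to the ordered pairs that are not vertex pairs lets
    one product over all ordered pairs describe the law of the edge set:
    configurations that are not edge sets have mass 0. *)
Definition edge_prob (R : realType) (kappa : R * R -> R) (n : nat)
    (w : 'I_n -> R) (ij : 'I_n * 'I_n) : R :=
  if ij \in vertex_pairs n then kappa (w ij.1, w ij.2) else 0.

Section RandomGraph.
Variables (R : realType) (kappa : R * R -> R) (n : nat) (d : measure_display).
Variables (T : measurableType d) (P : probability T R).
Variables (W : 'I_n -> {RV P >-> R}) (G : T -> rel 'I_n).
Hypothesis irg : inhomogeneous_random_graph kappa W G.

Lemma measurable_edge_set x : measurable [set t | edge_set (G t) = x].
Proof.
have -> : [set t | edge_set (G t) = x] = [set t | forall ij : 'I_n * 'I_n,
    ((ij \in vertex_pairs n) && G t ij.1 ij.2) = (ij \in x)].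
  apply/seteqP; split => t /= Gx; first by move=> ij; rewrite -Gx in_edge_set.
  by apply/setP => ij; rewrite in_edge_set Gx.
apply: (@measurable_fin_forall _ _ _ (fun ij : 'I_n * 'I_n => [set t |
    ((ij \in vertex_pairs n) && G t ij.1 ij.2) = (ij \in x)])) => ij.
have m := irg_measurable irg ij.1 ij.2.
case: (ij \in vertex_pairs n); case: (ij \in x) => //=.
- have -> : [set t | G t ij.1 ij.2 = false] = ~` [set t | G t ij.1 ij.2].
    by apply/seteqP; split => t /= => [->//|/negP/negbTE].
  exact: measurableC.
- have -> : [set t : T | false = true] = set0 by apply/seteqP; split.
  exact: measurable0.
- have -> : [set t : T | false = false] = setT by apply/seteqP; split.
  exact: measurableT.
Qed.

Let q t : 'I_n * 'I_n -> R := edge_prob kappa (fun i => W i t).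

(** The conditional law of the edges, integrated over the event setT. *)
Lemma edge_set_law x :
  P.-integrable setT (fun t => (config_mass (q t) x)%:E) /\
  P [set t | edge_set (G t) = x] = (\int[P]_t (config_mass (q t) x)%:E)%E.
Proof.
case: (boolP (x \subset vertex_pairs n)) => [xV|/fintype.subsetPn[ij ijx ijV]].
  have [sigmaY intY PY] := irg_edges irg (fun ij => ij \in x)
    (fintype.subxx (vertex_pairs n)).
  have massE t : config_mass (q t) x = \prod_(ij in vertex_pairs n)
      bernoulli_pmf (kappa (W ij.1 t, W ij.2 t)) (ij \in x).
    rewrite [RHS]big_mkcond; apply: eq_bigr => ij _.
    rewrite /bernoulli_pmf /q /edge_prob; case: (boolP (ij \in vertex_pairs n)) => //.
    by move=> ijV; rewrite (contraNF (fintype.subsetP xV ij) ijV) subr0.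
  have eq_set : [set t | forall ij, ij \in vertex_pairs n ->
      G t ij.1 ij.2 = (ij \in x)] = [set t | edge_set (G t) = x].
    apply/seteqP; split => t /= => [Gx|<- ij ijV]; last by rewrite in_edge_set ijV.
    apply/setP => ij; rewrite in_edge_set; case: (boolP (ij \in vertex_pairs n)) => [/Gx//|].
    by move=> ijV; rewrite (contraNF (fintype.subsetP xV ij) ijV).
  split; first by apply: eq_integrable intY => // t _; rewrite /= massE.
  have := PY setT; rewrite setIT eq_set => ->.
    by apply: eq_integral => t _; rewrite massE.
  by have := sigmaY setT measurableT; rewrite preimage_setT.
have mass0 t : config_mass (q t) x = 0.
  by rewrite /config_mass (bigD1 ij) //= ijx /q /edge_prob (negPf ijV) mul0r.
split.
  apply: (@eq_integrable _ _ _ _ _ _ (cst 0%E)) => //.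
    by move=> t _; rewrite mass0.
  exact: integrable0.
have -> : [set t | edge_set (G t) = x] = set0.
  apply/seteqP; split => t //= Gx; move: ijx ijV; rewrite -Gx in_edge_set.
  by move=> /andP[->].
rewrite measure0; apply/esym/integral0_eq => t _.
by rewrite mass0.
Qed.

Lemma edge_set_prob (E : pred {set 'I_n * 'I_n}) :
  P.-integrable setT (fun t => (prob (q t) E)%:E) /\
  P [set t | E (edge_set (G t))] = (\int[P]_t (prob (q t) E)%:E)%E.
Proof.
have probE t : ((prob (q t) E)%:E = \sum_(x | E x) (config_mass (q t) x)%:E)%E.
  rewrite sumEFin; congr (_%:E); rewrite [RHS]big_mkcond; apply: eq_bigr => x _ /=.
  by case: (E x); rewrite ?mulr1 ?mulr0.
have int_x x := (edge_set_law x).1.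
split.
  rewrite (_ : (fun t => _) = (fun t => \sum_(x | E x) (config_mass (q t) x)%:E)%E).
    by apply: integrable_sum.
  exact/funext.
rewrite (probability_fin_partition P E measurable_edge_set).2.
under [RHS]eq_integral do rewrite probE.
rewrite integral_sum //; apply: eq_bigr => x _.
exact: (edge_set_law x).2.
Qed.

End RandomGraph.
(** The image of [0, 1] under the contraction of ratio r towards c: it stays in
    [0, 1] and has length r, also when c is an end point. *)
Definition window (R : realType) (c r : R) : set R :=
  `[(1 - r) * c, (1 - r) * c + r]%classic.

Lemma uniform_prob_window (R : realType) (c r : R) :
  c \in `[0, 1] -> 0 < r <= 1 -> uniform_prob (@ltr01 R) (window c r) = r%:E.
Proof.
rewrite in_itv /= => /andP[c0 c1] /andP[r0 r1].
rewrite /uniform_prob.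
rewrite (eq_integral (fun=> 1%:E)); last first.
  move=> x; rewrite inE /window /= in_itv /= => /andP[x_ge x_le].
  rewrite /uniform_pdf subr0 invr1 ifT //.
  have rc : 0 <= (1 - r) * c by rewrite mulr_ge0 // subr_ge0.
  have rc1 : (1 - r) * c <= 1 - r by rewrite ler_piMr // subr_ge0.
  by apply/andP; split; lra.
rewrite /window integral_cst //= lebesgue_measure_itv /= mul1e lte_fin ltrDl r0 -EFinB.
by rewrite addrAC subrr add0r.
Qed.

Section Weights.
Variables (R : realType) (kappa : R * R -> R) (n : nat) (d : measure_display).
Variables (T : measurableType d) (P : probability T R).
Variables (W : 'I_n -> {RV P >-> R}) (G : T -> rel 'I_n).
Hypothesis irg : inhomogeneous_random_graph kappa W G.
Variables (U : set R) (r : R).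
Hypotheses (mU : measurable U) (PU : uniform_prob (@ltr01 R) U = r%:E).

Definition weights_in (w : 'I_n -> R) : {set 'I_n} := [set i | w i \in U]%SET.

Let X t := weights_in (fun i => W i t).

Let side (B : {set 'I_n}) (i : 'I_n) : set R := if i \in B then U else ~` U.

Let measurable_side B i : measurable (side B i).
Proof. by rewrite /side; case: ifP => _ //; exact: measurableC. Qed.

Let weights_in_eq B : [set t | X t = B] = [set t | forall i, side B i (W i t)].
Proof.
apply/seteqP; split => t /= XB.
  move=> i; rewrite /side -XB inE; case: ifPn; rewrite ?in_setE //.
  by move=> /negP; rewrite in_setE.
apply/setP => i; rewrite inE; have := XB i; rewrite /side.
by case: ifP => _; [exact: mem_set | exact: memNset].
Qed.

Lemma measurable_weights_in B : measurable [set t | X t = B].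
Proof.
rewrite weights_in_eq; apply: (@measurable_fin_forall _ _ _
  (fun i => W i @^-1` side B i)) => i.
rewrite -[X in measurable X]setTI; exact: measurable_funP.
Qed.

(** Independence of the weights for the events W i in U or its complement makes
    the set of vertices with weight in U a product of Bernoulli(r). *)
Lemma weights_in_law B : P [set t | X t = B] = (config_mass (fun=> r) B)%:E.
Proof.
rewrite weights_in_eq.
have -> : [set t | forall i, side B i (W i t)] =
    [set t | forall i, i \in [set: 'I_n]%SET -> side B i (W i t)].
  by apply/seteqP; split => t /= sideB i; [move=> _|]; apply: sideB; rewrite ?finset.in_setT.
rewrite (irg_weight_indep irg) => [|i _]; last exact: measurable_side.
rewrite /config_mass -prodEFin; apply: eq_big => [i|i _]; first by rewrite finset.in_setT.
have PWU : P (W i @^-1` U) = r%:E.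
  by rewrite -PU -(irg_weight_uniform irg i mU).
rewrite /side; case: ifP => _ //.
have mWU : measurable (W i @^-1` U).
  by rewrite -[X in measurable X]setTI; exact: measurable_funP.
by rewrite preimage_setC probability_setC // PWU.
Qed.

Lemma weights_in_prob (E : pred {set 'I_n}) :
  P [set t | E (X t)] = (prob (fun=> r) E)%:E.
Proof.
rewrite (probability_fin_partition P E measurable_weights_in).2.
under eq_bigr do rewrite weights_in_law.
rewrite sumEFin; congr (_%:E); rewrite big_mkcond; apply: eq_bigr => B _.
by case: (E B); rewrite ?mulr1 ?mulr0.
Qed.

Lemma measurable_weights_in_pred (E : pred {set 'I_n}) :
  measurable [set t | E (X t)].
Proof. exact: (probability_fin_partition P E measurable_weights_in).1. Qed.

End Weights.
Lemma kernel_window (R : realType) (kappa : R * R -> R) (c p0 : R) :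
  {within unit_square R, continuous kappa} -> c \in `[0, 1] ->
  p0 < kappa (c, c) ->
  exists2 r : R, 0 < r <= 1 & forall x y, x \in `[0, 1] -> y \in `[0, 1] ->
    window c r x -> window c r y -> p0 <= kappa (x, y).
Proof.
move=> /subspace_continuousP cont c01 p0_lt.
have cc : unit_square R (c, c) by split.
have /nbhs_ballP[e /= e0 e_ball] :
    nbhs (c, c) [set z | unit_square R z -> p0 < kappa z].
  exact: cvgr_gt (cont _ cc) _ p0_lt.
exists (Num.min 1 (e / 2)); first by rewrite lt_min ltr01 divr_gt0 //= ge_min lexx.
set r := Num.min _ _ => x y x01 y01 xw yw.
have r_lt : r < e.
  by apply: (@le_lt_trans _ _ (e / 2)); [rewrite ge_min lexx orbT | lra].
have r0 : 0 < r by rewrite lt_min ltr01 divr_gt0.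
have near_c z : window c r z -> ball c e z.
  rewrite /window /= in_itv /= => /andP[z_ge z_le]; rewrite -ball_normE /=.
  apply: le_lt_trans r_lt; move: c01; rewrite in_itv /= => /andP[c0 c1].
  have := ler_wpM2l (ltW r0) c0; have := ler_wpM2l (ltW r0) c1.
  by rewrite ler_norml => ? ?; apply/andP; split; lra.
by apply/ltW/(e_ball (x, y)); split => //=; exact: near_c.
Qed.

Lemma quasi_clique_numberE (R : realType) (gamma : R) (n : nat) (e : rel 'I_n) :
  quasi_clique_number gamma e =
  \max_(S : {set 'I_n} | dense_on gamma S (edge_set e)) #|S|.
Proof. by apply: eq_bigl => S; exact: quasi_clique_dense. Qed.

Theorem theorem1 (R : realType) (kappa : R * R -> R) (c gamma : R)
    (kappa_kernel : graph_kernel kappa)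
    (kappa_cont : {within unit_square R, continuous kappa})
    (c01 : c \in `[0, 1])
    (kappa_max : forall z, unit_square R z -> kappa z <= kappa (c, c))
    (gamma_gt : kappa (c, c) < gamma) (gamma_le1 : gamma <= 1)
    (d : nat -> measure_display) (T : forall n, measurableType (d n))
    (P : forall n, probability (T n) R)
    (W : forall n, 'I_n -> {RV (P n) >-> R})
    (G : forall n, T n -> rel 'I_n)
    (G_irg : forall n, inhomogeneous_random_graph kappa (W n) (@G n))
    (eps : R) (eps_gt0 : 0 < eps) :
  P n [set t |
       (1 - eps) * typical_size gamma (kappa (c, c)) n
         <= (quasi_clique_number gamma (@G n t))%:R
         <= (1 + eps) * typical_size gamma (kappa (c, c)) n]
    @[n --> \oo] --> 1%E.
Proof.
have [_ _ kappa01] := kappa_kernel.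
set p1 := kappa (c, c) in kappa_max gamma_gt *.
have cc : unit_square R (c, c) by split.
have /andP[p1_gt0 p1_lt1] := kappa01 _ cc.
have D0 := bernoulli_kl_gt0 p1_gt0 gamma_gt gamma_le1.
(* Shrinking eps strengthens the lower bound; its proof needs eps < 1. *)
pose eps' := Num.min eps (1 / 2).
have eps'01 : 0 < eps' < 1.
  rewrite lt_min eps_gt0 gt_min /=; apply/andP; split; first lra.
  by apply/orP; right; lra.
have [p0 /andP[p0_gt0 p0_lt] low] := prob_no_dense_small p1_gt0 gamma_gt gamma_le1 eps'01.
have [r /andP[r0 r1] r_window] := kernel_window kappa_cont c01 p0_lt.
have r01 : 0 <= r <= 1 by rewrite (ltW r0).
have half_r : r / 2 < r \/ r = 1 /\ r / 2 <= 1 by left; lra.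
have [rho rho01 few_tail] := lower_tail r01 half_r.
have eta0 : 0 < r / 2 by rewrite divr_gt0.
pose low_set n (x : {set 'I_n * 'I_n}) := [exists S : {set 'I_n},
  ((1 - eps') * typical_size gamma p1 n <= #|S|%:R) && dense_on gamma S x].
pose high_set n (x : {set 'I_n * 'I_n}) := [exists S : {set 'I_n},
  ((1 + eps) * typical_size gamma p1 n < #|S|%:R) && dense_on gamma S x].
pose ok n (x : {set 'I_n * 'I_n}) := ((1 - eps) * typical_size gamma p1 n
  <= (\max_(S : {set 'I_n} | dense_on gamma S x) #|S|)%:R
  <= (1 + eps) * typical_size gamma p1 n).
have typ0 n : 0 <= typical_size gamma p1 n.
  rewrite /typical_size divr_ge0 ?(ltW D0) // mulr_ge0 //.
  by case: n => [|n]; [rewrite ln0 | rewrite ln_ge0 // ler1n].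
have not_ok n x : ~~ ok n x -> ~~ low_set n x || high_set n x.
  apply: contraR; rewrite negb_or negbK negb_exists.
  move=> /andP[/existsP[S /andP[S_ge dS]] /forallP no_high].
  apply/andP; split.
    apply: (@le_trans _ _ ((1 - eps') * typical_size gamma p1 n)).
      by rewrite ler_wpM2r // lerD2l lerN2 ge_min lexx.
    by apply: (le_trans S_ge); rewrite ler_nat; exact: leq_bigmax_cond.
  have [S' dS' ->] : exists2 S' : {set 'I_n}, dense_on gamma S' x &
      \max_(S : {set 'I_n} | dense_on gamma S x) #|S| = #|S'|.
    have := @eq_bigmax_cond _ (fun S : {set 'I_n} => dense_on gamma S x) (fun S => #|S|).
    by case=> [|S' dS' ->]; [apply/card_gt0P; exists S | exists S'].
  by have := no_high S'; rewrite dS' andbT -leNgt.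
have eventE n : [set t | (1 - eps) * typical_size gamma p1 n
     <= (quasi_clique_number gamma (@G n t))%:R
     <= (1 + eps) * typical_size gamma p1 n] = [set t | ok n (edge_set (@G n t))].
  by apply/seteqP; split => t /=; rewrite /ok quasi_clique_numberE.
have m_ok n : measurable [set t | ok n (edge_set (@G n t))].
  exact: (probability_fin_partition (P n) (ok n) (measurable_edge_set (G_irg n))).1.
have fin_ok n : P n [set t | ok n (edge_set (@G n t))] \is a fin_num.
  exact: fin_num_measure.
pose few n (B : {set 'I_n}) := #|B|%:R < r / 2 * n%:R.
(* Averaging over the weights: the three errors come from sets that are too
   large, from the absence of large enough sets given enough vertices in the
   window, and from too few vertices in the window. *)
have prob_bound n delta (delta0 : 0 < delta) :
  (forall p : 'I_n * 'I_n -> R, (forall ij, 0 <= p ij <= 1) ->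
    (forall ij, ij \in vertex_pairs n -> p ij <= p1) ->
    prob p (high_set n) <= delta) ->
  (forall (p : 'I_n * 'I_n -> R) (A : {set 'I_n}),
    r / 2 * n%:R <= #|A|%:R -> (forall ij, 0 <= p ij <= 1) ->
    (forall ij, ij \in pairs_in A -> p0 <= p ij <= p1) ->
    prob p (fun x => ~~ low_set n x) <= delta) ->
  rho ^+ n <= delta ->
  ((1 - 3 * delta)%:E <= P n [set t | ok n (edge_set (@G n t))])%E.
  move=> high_small low_small rho_le.
  pose q t := edge_prob kappa (fun i => W n i t).
  pose A t := weights_in (window c r) (fun i => W n i t).
  have W01 i j t : unit_square R (W n i t, W n j t).
    by split; [exact: (irg_weight_range (G_irg n) i t) |
               exact: (irg_weight_range (G_irg n) j t)].
  have q01 t ij : 0 <= q t ij <= 1.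
    rewrite /q /edge_prob; case: ifP => _; last by rewrite lexx ler01.
    by have /andP[q0 q1] := kappa01 _ (W01 ij.1 ij.2 t); rewrite !ltW.
  have q_le t ij : ij \in vertex_pairs n -> q t ij <= p1.
    by rewrite /q /edge_prob => ->; exact: kappa_max.
  have q_A t ij : ij \in pairs_in (A t) -> p0 <= q t ij <= p1.
    rewrite inE => /and3P[ijV iA jA]; rewrite q_le // andbT /q /edge_prob ijV.
    rewrite /A /weights_in !finset.in_set !in_setE in iA jA.
    by apply: r_window => //; exact: irg_weight_range (G_irg n) _ _.
  have [q_int PE] := edge_set_prob (G_irg n) (ok n).
  have mw : measurable (window c r) by exact: measurable_itv.
  have Pw : uniform_prob (@ltr01 R) (window c r) = r%:E.
    by apply: uniform_prob_window => //; rewrite r0.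
  pose F := [set t | few n (A t)].
  have mF : measurable F by exact: measurable_weights_in_pred.
  have PF : (P n F <= delta%:E)%E.
    rewrite (weights_in_prob (G_irg n) mw Pw) lee_fin.
    apply: le_trans rho_le.
    have := few_tail _ (fun=> r) [set: 'I_n]%SET (fun=> r01) (fun _ _ => erefl).
    rewrite cardsT card_ord; apply: le_trans.
    by apply: prob_le => // B; rewrite /few finset.setIT.
  have pointwise t : 1 - 2 * delta <= prob (q t) (ok n) + \1_F t.
    rewrite probC.
    have bad_le : prob (q t) (predC (ok n)) <=
        prob (q t) (fun x => ~~ low_set n x) + prob (q t) (high_set n).
      by apply: prob_le_add => // x /=; exact: not_ok.
    have high_t := high_small _ (q01 t) (q_le t).
    case: (ltP #|A t|%:R (r / 2 * n%:R)) => [few_t|many_t].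
      have -> : \1_F t = 1 :> R by rewrite indicE mem_set.
      by have := prob_le1 (predC (ok n)) (q01 t); lra.
    have -> : \1_F t = 0 :> R by rewrite indicE memNset // /F /= /few ltNge many_t.
    by have := low_small _ _ many_t (q01 t) (q_A t); lra.
  have int_F : (P n).-integrable setT (fun t => (\1_F t)%:E).
    exact: integrable_indic.
  have le_int : ((1 - 2 * delta)%:E <= P n [set t | ok n (edge_set (@G n t))] + P n F)%E.
    rewrite PE -[X in (_ + P n X)%E]setIT -integral_indic // -integralD //.
    have -> : (1 - 2 * delta)%:E = (\int[P n]_t cst (1 - 2 * delta)%:E t)%E.
      by rewrite integral_cst // [X in (_ * X)%E]probability_setT mule1.
    apply: le_integral => //.
    - exact: finite_measure_integrable_cst.
    - exact: integrableD.
    - by move=> t _; rewrite lee_fin pointwise.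
  have := le_trans le_int (leeD2l _ PF).
  by rewrite -(fineK (fin_ok n)) -EFinD !lee_fin; lra.
apply/fine_cvgP; split; first by apply: nearW => n; rewrite eventE.
apply/cvgrPdist_le => delta delta0.
have delta3 : 0 < delta / 3 by rewrite divr_gt0.
have high_small := prob_large_dense_small p1_gt0 gamma_gt gamma_le1 eps_gt0 delta3.
have low_small := low _ _ eta0 delta3.
have /andP[rho0 rho1] := rho01.
have rho_small : \forall n \near \oo, rho ^+ n <= delta / 3.
  have rho_norm : `|rho| < 1 by rewrite gtr0_norm.
  by apply: filterS (cvgr_le _ (cvg_expr rho_norm) _ delta3).
near=> n; rewrite /= eventE.
have := prob_bound n _ delta3 _ _ _.
rewrite -(fineK (fin_ok n)) lee_fin => bound.
have le1 : fine (P n [set t | ok n (edge_set (@G n t))]) <= 1.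
  by rewrite -lee_fin fineK // probability_le1.
rewrite ger0_norm ?subr_ge0 // lerBlDr -lerBlDl.
have -> : 1 - delta = 1 - 3 * (delta / 3) by field.
by apply: bound; near: n.
Unshelve. all: by end_near. Qed.
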